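(* Let $G:\mathbb{C}\to\mathbb{C}^{m\times m}$ be a continuous-time, symmetric, real, rational, proper transfer function. Then $G(s)$ is C-SSNI if and only if all of the following hold: (i) $G(s)$ has all its poles with strictly negative real parts; (ii) $i\,[G(i\omega)-G(i\omega)^*]>0$ for all $\omega\in(0,\infty)$; (iii) there exist $\sigma_0>0$ and $\delta>0$ such that $\min\sigma\big[\omega^3\, i\,[G(i\omega)-G(i\omega)^*]\big]>\sigma_0$ for all $\omega\ge\delta$; (iv) $Q:=\lim_{\omega\to0^+}\frac{1}{\omega}\, i\,[G(i\omega)-G(i\omega)^*]>0$.
   Context: $i$ is the imaginary unit; $A^*$ is the conjugate transpose and $A^\top$ the transpose; $\ge0$ and $>0$ (likewise $\le 0$, $<0$) denote positive semidefiniteness and positive definiteness of Hermitian matrices; $\min\sigma[A]$ is the smallest singular value of $A$. A transfer function is real if $\overline{G(s)}=G(\bar s)$ (for rational $G$: entries are rational functions with real coefficients), symmetric if $G(s)=G(s)^\top$, and proper if $G(\infty)$ is finite. A function analytic or harmonic in a region $\Omega$ has full normal rank if its determinant is nonzero at some point of $\Omega$. C-NI (continuous negative imaginary): $G$ is analytic in $\{\mathrm{Re}\,s>0\}$ and, for all $s$ with $\mathrm{Re}\,s>0$: $i[G(s)-G(s)^*]\ge0$ if $\mathrm{Im}\,s>0$; $i[G(s)-G(s)^*]=0$ if $\mathrm{Im}\,s=0$; $i[G(s)-G(s)^*]\le0$ if $\mathrm{Im}\,s<0$. C-SSNI (continuous strongly strictly negative imaginary): a real transfer function $G$ such that, for some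 $\epsilon>0$, the transfer function $s\mapsto G(s-\epsilon)$ is C-NI, and $i[G(s)-G(-s)^\top]$ has full normal rank. *)

(* Defs.v *)
From HB Require Import structures.
From mathcomp Require Import all_boot all_order all_algebra.
From mathcomp Require Import complex.
From mathcomp Require Import all_classical all_reals all_analysis.

Set Implicit Arguments.
Unset Strict Implicit.
Unset Printing Implicit Defensive.

Import Order.TTheory GRing.Theory Num.Theory.
Import numFieldNormedType.Exports.

Local Open Scope classical_set_scope.
Local Open Scope ring_scope.
Local Open Scope sesquilinear_scope.

(* The complex numbers are R[i]; their topology lives on the alias R[i]^o. *)

Section HermitianMatrices.
Context {R : realType} {m : nat}.
Implicit Type A : 'M[R[i]]_m.

(* In R[i], 0 <= z (resp. 0 < z) means that z is real and nonnegative
   (resp. positive). *)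
Definition psd A : Prop :=
  A \is hermsymmx /\ forall x : 'cV[R[i]]_m, 0 <= (x ^t* *m A *m x) 0 0.

Definition pd A : Prop :=
  A \is hermsymmx /\
  forall x : 'cV[R[i]]_m, x != 0 -> 0 < (x ^t* *m A *m x) 0 0.

Definition nsd A : Prop := psd (- A).

Definition singular_value A (x : R) : Prop :=
  0 <= x /\ eigenvalue (A ^t* *m A) (x ^+ 2)%:C%C.

(* For 0 < m the set of singular values is finite and nonempty, so the
   infimum is a minimum. *)
Definition min_singular_value A : R := inf [set x | singular_value A x].

Definition ni_form A : 'M[R[i]]_m := 'i%C *: (A - A ^t*).

End HermitianMatrices.

Section TransferFunctions.
Context {R : realType} {m : nat}.
Implicit Type F : R[i] -> 'M[R[i]]_m.

(* Intended for open W. *)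
Definition analytic_on (W : set R[i]) F : Prop :=
  forall s, W s -> forall i j,
    derivable (fun z : R[i]^o => F z i j : R[i]^o) (s : R[i]^o) 1.

Definition real_tf F : Prop := forall s, map_mx Num.conj (F s) = F s^*.

Definition symmetric_tf F : Prop := forall s, F s = (F s)^T.

(* The value at infinity is the limit of F (1 / z) as z tends to 0. *)
Definition proper_tf F : Prop :=
  exists D : 'M[R[i]^o]_m,
    (F z^-1 : 'M[R[i]^o]_m) @[z --> (0 : R[i]^o)^'] --> D.

Definition full_normal_rank (W : set R[i]) F : Prop :=
  exists2 s, W s & \det (F s) != 0.

Definition C_NI F : Prop :=
  analytic_on [set s | 0 < complex.Re s] F /\
  forall s, 0 < complex.Re s ->
    [/\ 0 < complex.Im s -> psd (ni_form (F s)),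
        complex.Im s = 0 -> ni_form (F s) = 0
      & complex.Im s < 0 -> nsd (ni_form (F s))].

(* If F (s - eps) is C-NI, then F is analytic in Re s > - eps, and hence
   F s - (F (- s))^T is analytic in the strip - eps < Re s < eps. *)
Definition C_SSNI F : Prop :=
  real_tf F /\
  exists2 eps : R, 0 < eps &
    C_NI (fun s => F (s - eps%:C%C)) /\
    full_normal_rank [set s | - eps < complex.Re s < eps]
      (fun s => 'i%C *: (F s - (F (- s))^T)).

End TransferFunctions.

Section RationalMatrices.
Context {R : realType} {m : nat}.

(* Numerator and denominator in lowest terms, unique up to a common nonzero
   constant factor. *)
Definition fnum (f : {fraction {poly R[i]}}) : {poly R[i]} :=
  let: (n, d) := frac (repr f) in n %/ gcdp n d.

Definition fden (f : {fraction {poly R[i]}}) : {poly R[i]} :=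
  let: (n, d) := frac (repr f) in d %/ gcdp n d.

Definition pole (G : 'M[{fraction {poly R[i]}}]_m) (s : R[i]) : Prop :=
  exists i j, root (fden (G i j)) s.

(* An entry takes the junk value 0 at its poles. *)
Definition tf_eval (G : 'M[{fraction {poly R[i]}}]_m) (s : R[i]) :
    'M[R[i]]_m :=
  \matrix_(i, j) ((fnum (G i j)).[s] / (fden (G i j)).[s]).

End RationalMatrices.

(* Main.v *)
Require Import Defs.
From HB Require Import structures.
From mathcomp Require Import all_boot all_order all_algebra.
From mathcomp Require Import complex.
From mathcomp Require Import all_classical all_reals all_analysis.
From mathcomp Require Import ring lra.
Import Order.TTheory GRing.Theory Num.Theory.
Import numFieldNormedType.Exports.
Local Open Scope classical_set_scope.
Local Open Scope ring_scope.
Local Open Scope sesquilinear_scope.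

Set Implicit Arguments.
Unset Strict Implicit.
Unset Printing Implicit Defensive.

(** Let P(s) be the Hermitian matrix i [G(s) - H(s)], H(s) the conjugate
    transpose of G(s). As G is symmetric and real, P(s) = - 2 Im G(s) entrywise:
    a real symmetric matrix, odd under complex conjugation of s. So G is negative
    imaginary on a half-plane exactly when, for every real vector u, the scalar
    real rational function g = u G u^T satisfies Im g <= 0 on the part of that
    half-plane above the real axis. All entries share a real denominator q, and g
    is the quotient of [numform N u] by q.

    Necessity. Analyticity for Re s > - e leaves no pole there: the value 0
    assigned at a pole would contradict continuity ([derivable_no_pole]). Assume
    Im g <= 0 for Re s > - e and Im s > 0, and u nonzero. Then g is not
    constant: otherwise positivity puts u in the kernel of P on the imaginary
    axis, hence in that of G(s) - G(-s)^T for all s, against the full normal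
    rank ([nonconstant_form]). Near a point where it is regular, g minus its
    value is c z^k to leading order, z being the displacement, and the
    directions z allowed by the sign condition restrict c and k.
    - At i w all directions are allowed, which is impossible if Im g (i w) = 0;
      so P(i w) is positive definite ([im_neg_axis]).
    - At 0 a half-plane of directions is allowed, so k = 1 and c < 0; this
      is the positivity of the limit of P(i w) / w ([imQ0_neg]).
    - At infinity, with z = 1 / s, a quadrant is allowed, so k <= 2 and c > 0
      ([tcoef_infinity]). Writing G = D0 + D1 z + D2 z^2 + D3 z^3 + ..., the product
      w^3 P(i w) is 2 w^2 D1 - 2 D3 up to o(1). When D1 vanishes at u, so that the
      coefficient d2 of D2 is positive, the sign condition on the lines
      Re s = x < 0 inside the strip of analyticity reads d3 <= 2 x d2 in the
      limit, whence d3 < 0 ([im_regular_infinity]). Finsler's lemma makes this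
      uniform in u, which bounds w^3 P(i w) from below ([finsler]).

    Sufficiency. The conditions on P say that it is positive definite on the
    positive imaginary axis in a way that is uniform at 0 after division by w,
    and at infinity after multiplication by w^3. The expansions above show that
    this persists on a whole vertical line Re s = - e to the left, e small
    ([posdef_near_compact], [posdef_near_infinity]). Each Im g is harmonic to the
    right of that line, vanishes on the real axis and at infinity, and is nonpositive
    on the line, so it is nonpositive in between by the maximum principle
    ([maximum_principle]). The full normal rank holds since P(i) is positive
    definite.

    The minimal singular value of a positive definite real symmetric matrix is
    the minimum of its Rayleigh quotient, which translates singular values into
    bounds on forms ([min_singular_value_ge], [min_singular_value_coercive]). *)

(** * Real quadratic forms *)

Section QuadraticForms.
Context {R : realType} {m : nat}.
Implicit Types (A B : 'M[R]_m) (u v : 'rV[R]_m).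

Definition qform A u : R := \sum_i \sum_j A i j * u 0 i * u 0 j.
Definition sqnorm u : R := \sum_i u 0 i ^+ 2.
Definition posdef A : Prop := forall u, u != 0 -> 0 < qform A u.

Lemma qformD A B u : qform (A + B) u = qform A u + qform B u.
Proof.
rewrite /qform -big_split; apply: eq_bigr => i _ /=.
rewrite -big_split; apply: eq_bigr => j _ /=.
by rewrite !mxE !mulrDl.
Qed.

Lemma qformZ c A u : qform (c *: A) u = c * qform A u.
Proof.
rewrite /qform mulr_sumr; apply: eq_bigr => i _ /=.
by rewrite mulr_sumr; apply: eq_bigr => j _; rewrite !mxE !mulrA.
Qed.

Lemma qformN A u : qform (- A) u = - qform A u.
Proof. by rewrite -scaleN1r qformZ mulN1r. Qed.

Lemma qformB A B u : qform (A - B) u = qform A u - qform B u.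
Proof. by rewrite qformD qformN. Qed.

Lemma qform1 u : qform 1%:M u = sqnorm u.
Proof.
apply: eq_bigr => i _; rewrite (bigD1 i)//= big1 ?addr0.
  by rewrite !mxE eqxx mul1r.
by move=> j ji; rewrite !mxE eq_sym (negPf ji) !mul0r.
Qed.

Lemma qform_scale A c u : qform A (c *: u) = c ^+ 2 * qform A u.
Proof.
rewrite /qform mulr_sumr; apply: eq_bigr => i _ /=.
by rewrite mulr_sumr; apply: eq_bigr => j _; rewrite !mxE; ring.
Qed.

Lemma qform0 A : qform A 0 = 0.
Proof.
by rewrite /qform big1// => i _; rewrite big1// => j _; rewrite !mxE mulr0.
Qed.

Lemma sqnorm0 : sqnorm 0 = 0.
Proof. by rewrite -qform1 qform0. Qed.

Lemma sqnorm_ge0 u : 0 <= sqnorm u.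
Proof. by apply: sumr_ge0 => i _; exact: sqr_ge0. Qed.

Lemma sqnorm_gt0 u : u != 0 -> 0 < sqnorm u.
Proof.
move=> u0; rewrite lt0r sqnorm_ge0 andbT; apply: contra u0.
rewrite psumr_eq0 => [/allP h|i _]; last exact: sqr_ge0.
apply/eqP/rowP => i; rewrite mxE; apply/eqP.
by have := h i (mem_index_enum _); rewrite /= sqrf_eq0.
Qed.

Lemma entry_le_sqnorm u i j : `|u 0 i * u 0 j| <= sqnorm u.
Proof.
have le1 k : u 0 k ^+ 2 <= sqnorm u.
  by rewrite /sqnorm (bigD1 k)//= lerDl sumr_ge0// => l _; exact: sqr_ge0.
rewrite normrM; have := le1 i; have := le1 j.
rewrite -(real_normK (num_real (u 0 i))) -(real_normK (num_real (u 0 j))).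
have := sqr_ge0 (`|u 0 i| - `|u 0 j|); rewrite sqrrB; lra.
Qed.

(** Entrywise bounds are what limits of matrices provide; this turns them into
    bounds that are uniform on the sphere. *)
Lemma qform_small A e u : (forall i j, `|A i j| <= e) ->
  `|qform A u| <= e * (m * m)%:R * sqnorm u.
Proof.
move=> Ae; apply: (@le_trans _ _ (\sum_(i < m) \sum_(j < m) e * sqnorm u)).
  apply: (le_trans (ler_norm_sum _ _ _)); apply: ler_sum => i _.
  apply: (le_trans (ler_norm_sum _ _ _)); apply: ler_sum => j _.
  rewrite -mulrA normrM; apply: ler_pM => //; exact: entry_le_sqnorm.
rewrite !sumr_const !card_ord -mulrnA -[leLHS]mulr_natr.
by rewrite mulrAC.
Qed.

Lemma qform_continuous A : continuous (qform A).
Proof.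
move=> u; have FF : Filter (nbhs u) := nbhs_filter u; rewrite /qform.
apply: cvg_big => [|i _]; first exact: add_continuous.
apply: cvg_big => [|j _]; first exact: add_continuous.
apply: cvgM; last exact: coord_continuous.
by apply: cvgM; [exact: cvg_cst|exact: coord_continuous].
Qed.

Lemma sqnorm_continuous : continuous sqnorm.
Proof.
have -> : sqnorm = qform 1%:M by apply/funext => u; rewrite qform1.
exact: qform_continuous.
Qed.

Definition sphere : set 'rV[R]_m := [set u | sqnorm u = 1].

Lemma sphere_compact : compact sphere.
Proof.
apply: bounded_closed_compact.
  exists 1; split; first exact: num_real.
  move=> M M1 u /= u1; rewrite [leLHS]/Num.norm /= mx_normrE.
  apply: bigmax_le => [|[i j] _ /=]; first by lra.
  rewrite (ord1 i); have := entry_le_sqnorm u j j.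
  rewrite u1 -expr2 ger0_norm ?sqr_ge0//.
  rewrite -real_normK ?num_real// => h.
  have : `|u 0 j| <= 1 by rewrite -(@ler_pXn2r _ 2)// ?nnegrE// expr1n.
  lra.
rewrite (_ : sphere = sqnorm @^-1` [set 1]); last by [].
apply: closed_comp => [u _|]; first exact: sqnorm_continuous.
exact: closed_eq.
Qed.

Lemma sphere_homogeneous A c :
  (forall u, sphere u -> c <= qform A u) ->
  forall u, c * sqnorm u <= qform A u.
Proof.
move=> Ac u; have [->|u0] := eqVneq u 0.
  by rewrite qform0 sqnorm0 mulr0.
have n0 := sqnorm_gt0 u0.
have nn : (Num.sqrt (sqnorm u))^-1 ^+ 2 = (sqnorm u)^-1.
  by rewrite exprVn sqr_sqrtr// ltW.
have := Ac ((Num.sqrt (sqnorm u))^-1 *: u).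
rewrite /sphere/= -qform1 !qform_scale nn qform1 mulVf ?gt_eqF// => /(_ erefl).
by rewrite mulrC ler_pdivlMr.
Qed.

(** By compactness of the sphere; the minimizer of the Rayleigh quotient will
    serve as an eigenvector. *)
Lemma rayleigh_min A : (0 < m)%N ->
  exists l, exists2 u0, u0 != 0 &
    (forall u, l * sqnorm u <= qform A u) /\ qform A u0 = l * sqnorm u0.
Proof.
move=> m0.
have [||u0 /set_mem u01 umin] :=
  @compact_EVT_min _ R (qform A) sphere _ sphere_compact.
- exists (delta_mx 0 (Ordinal m0)).
  rewrite /sphere /= /sqnorm (bigD1 (Ordinal m0))//= big1 ?addr0.
    by rewrite mxE !eqxx expr1n.
  by move=> i /negPf h; rewrite mxE eqxx h expr0n.
- by apply: continuous_subspaceT; exact: qform_continuous.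
exists (qform A u0), u0; last split.
- by apply/eqP => u00; move: u01; rewrite /sphere /= u00 sqnorm0; lra.
- by apply: sphere_homogeneous => u us; apply: umin; exact/mem_set.
- by rewrite u01 mulr1.
Qed.

Lemma posdef_coercive A : posdef A ->
  exists2 c, 0 < c & forall u, c * sqnorm u <= qform A u.
Proof.
move=> A0; case: (posnP m) => [m0|m0].
  exists 1 => // u; rewrite (_ : u = 0); last first.
    by apply/rowP => -[i im]; exfalso; move: im; rewrite m0.
  by rewrite qform0 sqnorm0 mulr0.
have [l [u0 u00 [lA lu0]]] := rayleigh_min A m0.
exists l => //; move: (A0 _ u00); rewrite lu0.
by rewrite pmulr_lgt0// sqnorm_gt0.
Qed.

(** Dini's argument on the sphere: the forms n A + B increase with n, and each
    unit vector has a neighbourhood on which one of them is positive. *)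
Lemma finsler A B : (forall u, 0 <= qform A u) ->
  (forall u, u != 0 -> qform A u = 0 -> 0 < qform B u) ->
  exists n : nat, posdef (n%:R *: A + B).
Proof.
move=> A0 B0.
have := (compact_near_coveringP sphere).1 sphere_compact.
move=> /(_ nat \oo (fun n u => 0 < qform (n%:R *: A + B) u) _).
case=> [u us|n _ /(_ n (leqnn n)) /= h].
  have u0 : u != 0.
    by apply/eqP => u0; move: us; rewrite /sphere /= u0 sqnorm0; lra.
  have [n0 n0P] : exists n0 : nat, 0 < qform (n0%:R *: A + B) u.
    have := A0 u; rewrite le_eqVlt => /orP[/eqP/esym Au|Au].
      by exists 0; rewrite scale0r add0r B0.
    exists (Num.truncn (`|qform B u| / qform A u)).+1.
    rewrite qformD qformZ -ltrBlDr sub0r.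
    apply: (@le_lt_trans _ _ `|qform B u|); first by rewrite -normrN ler_norm.
    by rewrite -ltr_pdivrMr// truncnS_gt.
  have /= near_u : \forall v \near u, 0 < qform (n0%:R *: A + B) v.
    have /cvgr_gt h := @qform_continuous (n0%:R *: A + B) u.
    exact: h.
  near=> v n => /=.
  have n0n : (n0 <= n)%N by near: n; exact: nbhs_infty_ge.
  have v0 : 0 < qform (n0%:R *: A + B) v by near: v.
  apply: (lt_le_trans v0); rewrite !qformD !qformZ lerD2r.
  by rewrite ler_wpM2r// ler_nat.
exists n => u u0.
have := sqnorm_gt0 u0 => nu.
have nn : (Num.sqrt (sqnorm u))^-1 ^+ 2 = (sqnorm u)^-1.
  by rewrite exprVn sqr_sqrtr// ltW.
have := h ((Num.sqrt (sqnorm u))^-1 *: u).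
rewrite /sphere /= -qform1 !qform_scale nn qform1 mulVf ?gt_eqF// => /(_ erefl).
by rewrite pmulr_rgt0// invr_gt0.
Unshelve. all: by end_near.
Qed.

(** The form at u + t v has no constant term in t, so its nonnegativity for all
    small t of both signs forces the linear term to vanish. *)
Lemma psd_null A u : A^T = A -> (forall v, 0 <= qform A v) ->
  qform A u = 0 -> u *m A = 0.
Proof.
move=> As A0 Au.
pose b v := \sum_i \sum_j A i j * u 0 i * v 0 j.
have bE v t : qform A (u + t *: v) = t * (2 * b v) + t ^+ 2 * qform A v.
  suff -> : qform A (u + t *: v) =
      qform A u + (t * (2 * b v) + t ^+ 2 * qform A v) by rewrite Au add0r.
  have -> : 2 * b v = b v + \sum_i \sum_j A i j * v 0 i * u 0 j.
    rewrite mulr2n mulrDl mul1r; congr (_ + _); rewrite /b exchange_big.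
    apply: eq_bigr => i _; rewrite -[A in LHS]As.
    by apply: eq_bigr => j _; rewrite mxE mulrAC.
  rewrite /qform /b mulrDr !mulr_sumr -!big_split /=; apply: eq_bigr => i _.
  rewrite !mulr_sumr -!big_split /=; apply: eq_bigr => j _.
  by rewrite !mxE; ring.
have b0 v : b v = 0.
  have q0 := A0 v; set q := qform A v in q0 bE *.
  (* Any t of sign opposite to b v and small enough would do. *)
  have := A0 (u + (- (b v) / (q + 1)) *: v); rewrite bE -/q.
  have q1 : 0 < q + 1 by lra.
  have -> : - b v / (q + 1) * (2 * b v) + (- b v / (q + 1)) ^+ 2 * q
            = - (b v ^+ 2 * (q + 2)) / (q + 1) ^+ 2.
    by field; rewrite gt_eqF.
  rewrite ler_pdivlMr ?exprn_gt0// mul0r oppr_ge0 => h.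
  apply/eqP; rewrite -sqrf_eq0; apply/eqP/le_anti; rewrite sqr_ge0 andbT.
  by move: h; rewrite pmulr_lle0//; lra.
apply/rowP => j; rewrite !mxE.
have := b0 (delta_mx 0 j); rewrite /b => bj.
rewrite -[RHS]bj; apply: eq_bigr => i _.
rewrite (bigD1 j)//= big1 ?addr0; first by rewrite mxE !eqxx mulr1 mulrC.
by move=> k /negPf kj; rewrite mxE kj andbF mulr0.
Qed.

End QuadraticForms.

(** * Hermitian forms and singular values of real symmetric matrices *)

Section RealForms.
Context {R : realType} {m : nat}.
Implicit Types (A B : 'M[R]_m) (u v : 'rV[R]_m).

Definition cmx A : 'M[R[i]]_m := map_mx (real_complex R) A.

Lemma hform_cmx A (x : 'cV[R[i]]_m) : A^T = A ->
  (x ^t* *m cmx A *m x) 0 0 =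
  (qform A (\row_i complex.Re (x i 0)) + qform A (\row_i complex.Im (x i 0)))%:C%C.
Proof.
move=> As; pose u i := complex.Re (x i 0); pose v i := complex.Im (x i 0).
have termE i j : (x i 0)^*%C * (A i j)%:C%C * x j 0 =
    (A i j * (u i * u j + v i * v j))%:C%C +
    'i%C * (A i j * (u i * v j - v i * u j))%:C%C.
  rewrite /u /v; case: (x i 0) (x j 0) => [a b] [c d]; simpc => /=.
  by congr Complex; ring.
have -> : (x ^t* *m cmx A *m x) 0 0 =
    \sum_i \sum_j (x i 0)^*%C * (A i j)%:C%C * x j 0.
  rewrite mxE exchange_big /=; apply: eq_bigr => j _.
  by rewrite mxE mulr_suml; apply: eq_bigr => i _; rewrite !mxE.
under eq_bigr do under eq_bigr do rewrite termE.
under eq_bigr do rewrite big_split /= -mulr_sumr -!rmorph_sum /=.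
rewrite big_split /= -mulr_sumr -!rmorph_sum /=.
rewrite [X in _ + _ * X%:C%C](_ : _ = 0) ?mulr0 ?addr0.
  congr (_%:C%C); rewrite /qform -big_split; apply: eq_bigr => i _.
  rewrite -big_split; apply: eq_bigr => j _ /=; rewrite !mxE /u /v; ring.
under eq_bigr do under eq_bigr do rewrite mulrBr.
under eq_bigr do rewrite sumrB.
rewrite sumrB; apply/eqP; rewrite subr_eq0; apply/eqP.
rewrite exchange_big; apply: eq_bigr => j _; apply: eq_bigr => i _ /=.
by rewrite -[A in LHS]As mxE; ring.
Qed.

Lemma cmx_herm A : A^T = A -> cmx A \is hermsymmx.
Proof.
move=> As; apply/sesquiP; rewrite expr0 scale1r.
apply/matrixP => i j; rewrite -[A in LHS]As !mxE.
by rewrite [RHS]conjc_real.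
Qed.

Lemma psd_cmx A : A^T = A -> psd (cmx A) <-> forall u, 0 <= qform A u.
Proof.
move=> As; split=> [[_ h] u|h]; last first.
  by split; [exact: cmx_herm|move=> x; rewrite hform_cmx// ler0c addr_ge0].
have := h (\col_i (u 0 i)%:C%C); rewrite hform_cmx// ler0c.
rewrite [qform A (\row_i complex.Im _)](_ : _ = 0) ?addr0.
  by rewrite (_ : \row_i _ = u)//; apply/rowP => i; rewrite !mxE.
by rewrite (_ : \row_i _ = 0) ?qform0//; apply/rowP => i; rewrite !mxE.
Qed.

Lemma pd_cmx A : A^T = A -> pd (cmx A) <-> posdef A.
Proof.
move=> As; split=> [[_ h] u u0|h].
  have := h (\col_i (u 0 i)%:C%C); rewrite hform_cmx//.
  rewrite [qform A (\row_i complex.Im _)](_ : _ = 0) ?addr0; last first.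
    by rewrite (_ : \row_i _ = 0) ?qform0//; apply/rowP => i; rewrite !mxE.
  rewrite (_ : \row_i _ = u); last by apply/rowP => i; rewrite !mxE.
  rewrite ltcR; apply; apply: contra u0 => /eqP/colP h0.
  by apply/eqP/rowP => i; have := h0 i; rewrite !mxE => -[].
split=> [|x x0]; first exact: cmx_herm.
have ge0 u : 0 <= qform A u.
  have [->|/h/ltW//] := eqVneq u 0; by rewrite qform0.
rewrite hform_cmx// ltcR.
have [u0|u0] := eqVneq (\row_i complex.Re (x i 0)) 0; last first.
  by rewrite ltr_pwDl// h.
rewrite ltr_wpDl// h//; apply: contra x0 => /eqP v0.
apply/eqP/colP => i; move/rowP/(_ i): u0; move/rowP/(_ i): v0.
by rewrite !mxE; case: (x i 0) => a b /= -> ->.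
Qed.

(** A complex eigenvector of a real symmetric matrix for l splits into real and
    imaginary parts, so l lies above any lower bound of the form. *)
Lemma eigen_lower_bound A c (l : R) (w : 'rV[R[i]]_m) : A^T = A ->
  (forall u, c * sqnorm u <= qform A u) -> w != 0 ->
  w *m cmx A = l%:C%C *: w -> c <= l.
Proof.
move=> As Ac w0 wA.
pose u := \row_i complex.Re (w 0 i); pose v := \row_i complex.Im (w 0 i).
pose x : 'cV[R[i]]_m := w ^t*.
have hE B : B^T = B -> (x ^t* *m cmx B *m x) 0 0 = (qform B u + qform B v)%:C%C.
  move=> Bs; rewrite hform_cmx//; congr (_ + _)%:C%C.
    by congr qform; apply/rowP => i; rewrite !mxE; case: (w 0 i).
  rewrite (_ : \row_i _ = (-1) *: v) ?qform_scale ?sqrrN ?expr1n ?mul1r//.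
  by apply/rowP => i; rewrite !mxE mulN1r; case: (w 0 i).
have xw : x ^t* = w by rewrite /x trmxCK.
have := hE _ As; rewrite xw wA -scalemxAl.
have := hE _ (@tr_scalar_mx _ m 1).
rewrite xw /cmx map_scalar_mx mulmx1 !qform1 => wx.
rewrite [LHS]mxE wx -rmorphM => -[hq].
have := lerD (Ac u) (Ac v); rewrite -hq -mulrDr ler_pM2r//.
have n0 := sqnorm_ge0 u; have n1 := sqnorm_ge0 v.
have [u0|/sqnorm_gt0] := eqVneq u 0; last by lra.
suff : v != 0 by move/sqnorm_gt0; lra.
apply: contra w0 => /eqP v0; apply/eqP/rowP => i.
move/rowP/(_ i): u0; move/rowP/(_ i): v0.
by rewrite !mxE; case: (w 0 i) => a b /= -> ->.
Qed.

Lemma cmx_ctr A : A^T = A -> (cmx A) ^t* = cmx A.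
Proof.
move=> As; apply/matrixP => i j; rewrite !mxE -[A in RHS]As mxE.
exact: conjc_real.
Qed.

(** If x^2 is an eigenvalue of A^2 with eigenvector w, then w (A + x) is an
    eigenvector of A for x, unless it is 0, in which case w is one for - x. *)
Lemma singular_value_coercive A c x : A^T = A -> 0 <= c ->
  (forall u, c * sqnorm u <= qform A u) ->
  singular_value (cmx A) x -> c <= x.
Proof.
move=> As c0 Ac [x0]; rewrite cmx_ctr// => /eigenvalueP[w wA w0].
pose z := w *m cmx A + x%:C%C *: w.
have [z0|zN0] := eqVneq z 0.
  have wA' : w *m cmx A = (- x)%:C%C *: w.
    by move: z0 => /eqP; rewrite addr_eq0 => /eqP ->; rewrite rmorphN scaleNr.
  by have := eigen_lower_bound As Ac w0 wA'; lra.
apply: (eigen_lower_bound As Ac zN0).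
rewrite /z mulmxDl -mulmxA wA -scalemxAl scalerDr scalerA -rmorphM /=.
by rewrite addrC expr2.
Qed.

(** Where the Rayleigh quotient has its minimum l, the nonnegative form of
    A - l vanishes, so the minimizer is an eigenvector for l. *)
Lemma singular_value_rayleigh A c : (0 < m)%N -> A^T = A -> 0 < c ->
  (forall u, c * sqnorm u <= qform A u) ->
  exists2 l, singular_value (cmx A) l & forall u, l * sqnorm u <= qform A u.
Proof.
move=> m0 As c0 Ac; have [l [u u0 [lA lu]]] := rayleigh_min A m0.
exists l => //.
have nu := sqnorm_gt0 u0.
have l0 : 0 <= l by have := Ac u; rewrite lu ler_pM2r//; lra.
have uA : u *m A = l *: u.
  apply/eqP; rewrite -subr_eq0; apply/eqP.
  have -> : u *m A - l *: u = u *m (A - l%:M) by rewrite mulmxBr mul_mx_scalar.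
  apply: psd_null.
  - by rewrite linearB /= As tr_scalar_mx.
  - move=> v; rewrite qformB -[l%:M]scalemx1 qformZ qform1 subr_ge0//.
  - by rewrite qformB -[l%:M]scalemx1 qformZ qform1 lu subrr.
split => //; rewrite cmx_ctr//; apply/eigenvalueP.
exists (map_mx (real_complex R) u).
  rewrite /cmx mulmxA -!map_mxM /= uA -scalemxAl uA scalerA map_mxZ.
  by rewrite /= expr2.
by rewrite map_mx_eq0.
Qed.

Lemma min_singular_value_ge A c : (0 < m)%N -> A^T = A -> 0 < c ->
  (forall u, c * sqnorm u <= qform A u) -> c <= min_singular_value (cmx A).
Proof.
move=> m0 As c0 Ac; apply: lb_le_inf.
  by have [l ? _] := singular_value_rayleigh m0 As c0 Ac; exists l.
by move=> x /= hx; apply: singular_value_coercive hx => //; exact: ltW.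
Qed.

Lemma min_singular_value_coercive A c : (0 < m)%N -> A^T = A -> posdef A ->
  c < min_singular_value (cmx A) -> forall u, c * sqnorm u <= qform A u.
Proof.
move=> m0 As A0 cA u; have [d d0 Ad] := posdef_coercive A0.
have [l lA lu] := singular_value_rayleigh m0 As d0 Ad.
apply: (le_trans _ (lu u)); rewrite ler_wpM2r ?sqnorm_ge0//.
apply: (le_trans (ltW cA)); apply: ge_inf => //.
by exists 0 => x [].
Qed.

(** Coercivity makes positive definiteness an open condition on the entries. *)
Lemma posdef_near (T : Type) (F : set_system T) {FF : Filter F}
    (M : T -> 'M[R]_m) A :
  (forall i j, (fun t => M t i j) @ F --> A i j) -> posdef A ->
  \forall t \near F, posdef (M t).
Proof.
move=> MA /posdef_coercive[c c0 Ac].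
pose e := c / (2 * (m * m).+1%:R).
have e0 : 0 < e by rewrite divr_gt0// mulr_gt0// ltr0n.
have : \forall t \near F, forall i j, `|(M t - A) i j| <= e.
  apply: filter_forall => i; apply: filter_forall => j.
  have /cvgrPdist_le/(_ _ e0) := MA i j; apply: filterS => t.
  by rewrite !mxE distrC.
apply: filterS => t /(qform_small) h u /sqnorm_gt0 u0.
have := h u; rewrite qformB ler_norml => /andP[h1 _].
have := Ac u => h2.
suff : e * (m * m)%:R * sqnorm u < c * sqnorm u by lra.
rewrite ltr_pM2r// /e mulrAC ltr_pdivrMr ?mulr_gt0 ?ltr0n// ltr_pM2l//.
by rewrite -natr1; have := ler0n R (m * m); lra.
Qed.

End RealForms.

(** * Real rational functions in real coordinates *)

Section RealPolys.
Context {R : realType}.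
Implicit Types (p q : {poly R}) (s : R[i]) (x y : R).

Definition ceval p s : R[i] := (map_poly (real_complex R) p).[s].
Definition ratval p q s : R[i] := ceval p s / ceval q s.

(** Real part, and imaginary part divided by y, of the polynomial with
    coefficients l at x + i y. Both are polynomials in x and y: after division by
    y, signs of imaginary parts are stable under perturbation up to the real axis. *)
Fixpoint reim (l : seq R) (z : R * R) : R * R :=
  if l is c :: l' then
    let: (a, b) := reim l' z in
    (a * z.1 - z.2 ^+ 2 * b + c, a + b * z.1)
  else (0, 0).

Lemma cevalE p x y :
  ceval p (Complex x y) = Complex (reim p (x, y)).1 (y * (reim p (x, y)).2).
Proof.
rewrite /ceval map_polyE horner_Poly.
elim: (polyseq p) => [|c l IH] /=; first by rewrite mulr0.
rewrite IH; case: (reim l (x, y)) => a b /=; simpc.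
by congr Complex; ring.
Qed.

Lemma reim_continuous (l : seq R) :
  continuous (fun z => (reim l z).1) /\ continuous (fun z => (reim l z).2).
Proof.
elim: l => [|c l [IH1 IH2]] /=; first by split => z; exact: cvg_cst.
have -> : (fun z => (let: (a, b) := reim l z in
    (a * z.1 - z.2 ^+ 2 * b + c, a + b * z.1)).1) =
    (fun z => (reim l z).1 * z.1 - z.2 ^+ 2 * (reim l z).2 + c).
  by apply/funext => z; case: (reim l z).
have -> : (fun z => (let: (a, b) := reim l z in
    (a * z.1 - z.2 ^+ 2 * b + c, a + b * z.1)).2) =
    (fun z => (reim l z).1 + (reim l z).2 * z.1).
  by apply/funext => z; case: (reim l z).
split => z.
  apply: cvgD; last exact: cvg_cst.
  apply: cvgB; first by apply: cvgM; [exact: IH1|exact: cvg_fst].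
  apply: cvgM; last exact: IH2.
  by under eq_fun do rewrite expr2; apply: cvgM; exact: cvg_snd.
apply: cvgD; first exact: IH1.
by apply: cvgM; [exact: IH2|exact: cvg_fst].
Qed.

Definition sqabs q (z : R * R) : R :=
  (reim q z).1 ^+ 2 + z.2 ^+ 2 * (reim q z).2 ^+ 2.
Definition reQ p q (z : R * R) : R :=
  ((reim p z).1 * (reim q z).1 + z.2 ^+ 2 * ((reim p z).2 * (reim q z).2))
  / sqabs q z.
Definition imQ p q (z : R * R) : R :=
  ((reim p z).2 * (reim q z).1 - (reim p z).1 * (reim q z).2) / sqabs q z.

Lemma ratvalE p q x y :
  ratval p q (Complex x y) = Complex (reQ p q (x, y)) (y * imQ p q (x, y)).
Proof.
rewrite /ratval !cevalE /reQ /imQ /sqabs /=.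
case: (reim p _) => a b; case: (reim q _) => c d /=.
rewrite -[_^-1]/(Complex _ _) -[LHS]/(Complex _ _) exprMn.
by congr Complex; ring.
Qed.

Lemma sqabs_neq0 q z : ceval q (Complex z.1 z.2) != 0 -> sqabs q z != 0.
Proof.
case: z => x y; rewrite cevalE /sqabs /=; apply: contra.
rewrite -exprMn paddr_eq0 ?sqr_ge0// !sqrf_eq0 => /andP[/eqP -> h].
by rewrite eq_complex /= eqxx.
Qed.

Lemma sqabs_continuous q : continuous (sqabs q).
Proof.
have [c1 c2] := reim_continuous q.
move=> z; rewrite /sqabs; under eq_fun do rewrite !expr2.
apply: cvgD; first by apply: cvgM; exact: c1.
by apply: cvgM; apply: cvgM; try exact: cvg_snd; exact: c2.
Qed.

Lemma reQ_continuous p q z : ceval q (Complex z.1 z.2) != 0 ->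
  {for z, continuous (reQ p q)}.
Proof.
move=> qz; have [c1 c2] := reim_continuous q; have [d1 d2] := reim_continuous p.
apply: cvgM; last by apply: cvgV; [exact: sqabs_neq0|exact: sqabs_continuous].
apply: cvgD; first by apply: cvgM; [exact: d1|exact: c1].
apply: cvgM; last by apply: cvgM; [exact: d2|exact: c2].
by under eq_fun do rewrite expr2; apply: cvgM; exact: cvg_snd.
Qed.

Lemma imQ_continuous p q z : ceval q (Complex z.1 z.2) != 0 ->
  {for z, continuous (imQ p q)}.
Proof.
move=> qz; have [c1 c2] := reim_continuous q; have [d1 d2] := reim_continuous p.
apply: cvgM; last by apply: cvgV; [exact: sqabs_neq0|exact: sqabs_continuous].
apply: cvgB; first by apply: cvgM; [exact: d2|exact: c1].
by apply: cvgM; [exact: d1|exact: c2].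
Qed.

Lemma Im_div_gt0 (a b : R[i]) :
  (0 < complex.Im (a / b)) = (0 < complex.Im (a * b^*%C)).
Proof.
have [->|b0] := eqVneq b 0; first by rewrite invr0 conjc0.
have -> : complex.Im (a / b) =
    complex.Im (a * b^*%C) / (complex.Re b ^+ 2 + complex.Im b ^+ 2).
  by case: a b {b0} => [a1 a2] [b1 b2] /=; ring.
rewrite pmulr_lgt0// invr_gt0 lt0r addr_ge0 ?sqr_ge0// andbT.
apply: contra b0; rewrite paddr_eq0 ?sqr_ge0// !sqrf_eq0.
by case: b => b1 b2 /= /andP[/eqP -> /eqP ->].
Qed.

Lemma Im_horner_real (f : {poly R[i]}) :
  exists h : {poly R}, forall t : R, complex.Im f.[t%:C%C] = h.[t].
Proof.
exists (map_poly (@complex.Im R) f) => t.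
have im0 : complex.Im (0 : R[i]) = 0 by [].
have re0 : complex.Re (0 : R[i]) = 0 by [].
have -> : f = map_poly (real_complex R) (map_poly (@complex.Re R) f) +
    'i%C *: map_poly (real_complex R) (map_poly (@complex.Im R) f).
  by apply/polyP => i; rewrite coefD coefZ !coef_map_id0// [LHS]complexE.
rewrite hornerD hornerZ !horner_map /=.
set g := map_poly _ (_ + _).
have -> : g = map_poly (@complex.Im R) f.
  apply/polyP => i; rewrite /g !coef_map_id0// coefD coefZ !coef_map_id0//.
  by rewrite -complexE.
by simpc.
Qed.

(** The sign of Im (w^k r(s0) / q(s0)) decides the sign of
    Im (z^k r(s0 + z) / q(s0 + z)) along the initial part of the ray z = t w: up to
    positive factors, the latter is a real polynomial in t. *)
Lemma ray_test (r q : {poly R[i]}) s0 w k :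
  0 < complex.Im (w ^+ k * (r.[s0] / q.[s0])) ->
  \forall t \near (0 : R)^'+, 0 < complex.Im
    ((t%:C%C * w) ^+ k * (r.[s0 + t%:C%C * w] / q.[s0 + t%:C%C * w])).
Proof.
pose l := s0%:P + w *: 'X.
pose f := (w ^+ k *: (r \Po l)) * map_poly conjc (q \Po l).
have lE t : l.[t%:C%C] = s0 + t%:C%C * w by rewrite /l !hornerE mulrC.
have [h hE] := Im_horner_real f.
have fE t : f.[t%:C%C] = w ^+ k * r.[s0 + t%:C%C * w] * (q.[s0 + t%:C%C * w])^*%C.
  rewrite /f hornerM hornerZ horner_comp lE; congr (_ * _).
  by rewrite -[X in _.[X]]conjc_real horner_map /= horner_comp lE.
rewrite mulrA Im_div_gt0 => h0.
have : 0 < h.[0] by rewrite -hE fE mul0r addr0.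
have hc : h.[t] @[t --> (0 : R)^'+] --> h.[0].
  exact/cvg_at_right_filter/continuous_horner.
have /cvgr_gt hg := hc => /hg; move: (nbhs_right_gt (0 : R)).
apply: filterS2 => t t0 ht.
rewrite exprMn -mulrA -rmorphXn mulrA -mulrA.
have : 0 < complex.Im (w ^+ k * r.[s0 + t%:C%C * w] / q.[s0 + t%:C%C * w]).
  by rewrite Im_div_gt0 -fE hE.
rewrite -mulrA; case: (w ^+ k * _) => a b /=; simpc => /= b0.
by rewrite mulr_gt0// exprn_gt0.
Qed.
End RealPolys.

(** * Directions, open mapping and reversed polynomials *)

Section Directions.
Context {R : realType}.

Definition cis (x : R) : R[i] := Complex (cos x) (sin x).

Lemma cis_exp x k : cis x ^+ k = cis (x * k%:R).
Proof.
elim: k => [|k IH]; first by rewrite mulr0 /cis cos0 sin0.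
rewrite exprS IH /cis -natr1 mulrDr mulr1 cosD sinD.
rewrite -[LHS]/(Complex _ _); congr Complex; ring.
Qed.

(** The angle pi / (4 k), whose k-fold multiple has a positive sine. *)
Lemma direction_pos k : (0 < k)%N -> exists w : R[i],
  [/\ 0 < complex.Re w, 0 < complex.Im w & 0 < complex.Im (w ^+ k)].
Proof.
move=> k0; have kR : 1 <= k%:R :> R by rewrite ler1n.
have p0 := pi_gt0 R; pose x := pi / 4 / k%:R : R.
have x0 : 0 < x by rewrite !divr_gt0//; lra.
have xk : x * k%:R = pi / 4 by rewrite /x divfK// gt_eqF//; lra.
have x4 : x <= pi / 4 by rewrite -xk ler_peMr// ltW.
exists (cis x); split.
- by apply: cos_gt0_pihalf; lra.
- by apply: sin_gt0_pi; lra.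
- by rewrite cis_exp xk; apply: sin_gt0_pi; lra.
Qed.

(** The angle 5 pi / (4 k), whose k-fold multiple has a negative sine; it is
    below pi as soon as k >= 2, and below pi / 2 as soon as k >= 3. *)
Lemma direction_neg k : (1 < k)%N -> exists w : R[i],
  [/\ (2 < k)%N -> 0 < complex.Re w, 0 < complex.Im w & complex.Im (w ^+ k) < 0].
Proof.
move=> k1; have kR : 2 <= k%:R :> R by rewrite ler_nat.
have p0 := pi_gt0 R; pose x := 5 * pi / 4 / k%:R : R.
have x0 : 0 < x by rewrite !divr_gt0 ?mulr_gt0//; lra.
have xk : x * k%:R = 5 * pi / 4 by rewrite /x divfK// gt_eqF//; lra.
exists (cis x); split.
- move=> k2; have k3 : 3 <= k%:R :> R by rewrite ler_nat.
  by apply: cos_gt0_pihalf; nra.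
- by apply: sin_gt0_pi; nra.
- rewrite cis_exp xk /= (_ : 5 * pi / 4 = pi / 4 + pi); last by lra.
  by rewrite sinDpi oppr_lt0; apply: sin_gt0_pi; lra.
Qed.

Lemma ray_value (p q r : {poly R[i]}) c s0 z k :
  p = c *: q + r * ('X - s0%:P) ^+ k ->
  0 < complex.Im (z ^+ k * (r.[s0 + z] / q.[s0 + z])) ->
  p.[s0 + z] / q.[s0 + z] = c + z ^+ k * (r.[s0 + z] / q.[s0 + z]).
Proof.
move=> -> h.
have q0 : q.[s0 + z] != 0.
  by apply/eqP => q0; move: h; rewrite q0 invr0 !mulr0 /= ltxx.
have -> : (c *: q + r * ('X - s0%:P) ^+ k).[s0 + z] =
    c * q.[s0 + z] + r.[s0 + z] * z ^+ k.
  by rewrite !hornerE [s0 + z]addrC addrK.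
by field.
Qed.

(** The open mapping property for rational functions: the leading term c z^k of
    the increment takes the value i in the direction of a k-th root of i / c. *)
Lemma Im_increases (p q : {poly R[i]}) s0 : q.[s0] != 0 ->
  p != (p.[s0] / q.[s0]) *: q ->
  exists w : R[i], \forall t \near (0 : R)^'+,
    complex.Im (p.[s0] / q.[s0]) <
    complex.Im (p.[s0 + t%:C%C * w] / q.[s0 + t%:C%C * w]).
Proof.
move=> q0; set c := _ / _ => pcq.
have [k [r]] := multiplicity_XsubC (p - c *: q) s0.
rewrite subr_eq0 pcq /= => r0 /eqP; rewrite subr_eq addrC => /eqP pE.
have k0 : (0 < k)%N.
  case: k pE => // pE; move/(congr1 (horner^~ s0)): pE.
  rewrite expr0 mulr1 !hornerE divfK// => /eqP.
  by rewrite -subr_eq0 opprD addrA subrr sub0r oppr_eq0 => /(negP r0).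
exists (k.-root ('i%C * q.[s0] / r.[s0])).
have : 0 < complex.Im ((k.-root ('i%C * q.[s0] / r.[s0])) ^+ k * (r.[s0] / q.[s0])).
  rewrite rootCK// (_ : _ / _ * _ = 'i%C); first by rewrite /= ltr01.
  by field; rewrite q0 -rootE r0.
move/ray_test; apply: filterS => t ht.
rewrite (ray_value pE ht); move: ht; case: (_ * (_ / _)) => a b /=.
by case: (c) => c1 c2 /=; rewrite ltrDl.
Qed.

End Directions.

Section PolyLemmas.
Context {F : fieldType}.
Implicit Types p q : {poly F}.

Lemma poly_eq0_inj (f : nat -> F) p : injective f ->
  (forall n, p.[f n] = 0) -> p = 0.
Proof.
move=> fI f0; apply/eqP; apply: contraT => p0.
have := @max_poly_roots _ p [seq f i | i <- iota 0 (size p)] p0.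
rewrite map_inj_uniq// iota_uniq size_map size_iota ltnn => -> //.
by apply/allP => _ /mapP[i _ ->]; rewrite rootE f0.
Qed.

(** The polynomial z^n p(1 / z), for p of degree at most n. *)
Definition revp n p : {poly F} := \poly_(i < n.+1) p`_(n - i).

Lemma revpE n p z : (size p <= n.+1)%N -> z != 0 ->
  (revp n p).[z] = z ^+ n * p.[z^-1].
Proof.
move=> pn z0; rewrite horner_poly (horner_coef_wide _ pn) mulr_sumr.
rewrite (reindex_inj rev_ord_inj) /=; apply: eq_bigr => i _.
have lein : (i <= n)%N by rewrite -ltnS.
rewrite !subSS subKn// mulrCA; congr (_ * _).
have -> : z ^+ n = z ^+ (n - i) * z ^+ i by rewrite -exprD subnK.
by rewrite -mulrA exprVn divff ?expf_neq0// mulr1.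
Qed.

Lemma revp0 n p : (revp n p).[0] = p`_n.
Proof. by rewrite horner_coef0 coef_poly /= subn0. Qed.

End PolyLemmas.

Lemma map_revp (F K : fieldType) (f : {rmorphism F -> K}) n (p : {poly F}) :
  map_poly f (revp n p) = revp n (map_poly f p).
Proof.
apply/polyP => i; rewrite coef_map [in LHS]coef_poly [RHS]coef_poly.
case: ifP => // _.
  by rewrite coef_map.
exact: rmorph0.
Qed.

(** * Third-order expansion at infinity *)

Section Expansion.
Context {R : realType}.
Implicit Types (p q r : {poly R}) (s : R[i]) (x t c : R).

Lemma ImD (a b : R[i]) : complex.Im (a + b) = complex.Im a + complex.Im b.
Proof. by case: a b => [? ?] []. Qed.

Lemma cevalD p r s : ceval (p + r) s = ceval p s + ceval r s.
Proof. by rewrite /ceval rmorphD hornerD. Qed.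

Lemma cevalM p r s : ceval (p * r) s = ceval p s * ceval r s.
Proof. by rewrite /ceval rmorphM hornerM. Qed.

Lemma cevalZ c p s : ceval (c *: p) s = c%:C%C * ceval p s.
Proof. by rewrite /ceval map_polyZ hornerZ. Qed.

Lemma cevalX s : ceval 'X s = s.
Proof. by rewrite /ceval map_polyX hornerX. Qed.

Lemma ceval_real p x : ceval p x%:C%C = (p.[x])%:C%C.
Proof. by rewrite /ceval horner_map. Qed.

(** Passing to the variable 1 / s exchanges the behaviours at infinity and at 0. *)
Lemma ratval_inv n p q s : (size p <= n.+1)%N -> (size q <= n.+1)%N -> s != 0 ->
  ratval p q s = ratval (revp n p) (revp n q) s^-1.
Proof.
move=> pn qn s0; rewrite /ratval /ceval !map_revp.
have sV : s^-1 != 0 by rewrite invr_eq0.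
rewrite !revpE ?size_map_poly// invrK invfM mulrACA divff ?mul1r//.
by rewrite expf_neq0.
Qed.

Lemma revp_neq0 n q s : (size q <= n.+1)%N -> s != 0 ->
  ceval q s != 0 -> ceval (revp n q) s^-1 != 0.
Proof.
move=> qn s0; have sV : s^-1 != 0 by rewrite invr_eq0.
rewrite /ceval map_revp revpE ?size_map_poly// invrK => h.
by rewrite mulf_neq0// expf_neq0.
Qed.

(** The value c of p / q at 0, and the numerator over q of (p / q - c) / X. Being
    given by formulas, they are linear in p, and so commute with the formation of
    quadratic forms. *)
Definition tcoef q p : R := p.[0] / q.[0].
Definition trest q p : {poly R} := drop_poly 1 (p - tcoef q p *: q).

Lemma taylor_step q p : q.[0] != 0 -> p = tcoef q p *: q + 'X * trest q p.
Proof.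
move=> q0; rewrite /trest; set g := p - _.
have g0 : g`_0 = 0 by rewrite -horner_coef0 /g !hornerE /tcoef divfK// subrr.
have -> : 'X * drop_poly 1 g = g.
  apply/polyP => i; rewrite coefXM; case: i => [|i] /=; first by rewrite g0.
  by rewrite coef_drop_poly addn1.
by rewrite /g addrC subrK.
Qed.

Lemma tcoef_linear q c p r : tcoef q (c *: p + r) = c * tcoef q p + tcoef q r.
Proof. by rewrite /tcoef hornerD hornerZ; ring. Qed.

Lemma trest_linear q c p r : trest q (c *: p + r) = c *: trest q p + trest q r.
Proof.
rewrite /trest tcoef_linear.
have -> : c *: p + r - (c * tcoef q p + tcoef q r) *: q =
    c *: (p - tcoef q p *: q) + (r - tcoef q r *: q).
  by rewrite scalerDl scalerBr scalerA opprD addrACA.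
by rewrite [LHS]drop_polyD drop_polyZ.
Qed.

Lemma ratval_linear q s c p r :
  ratval (c *: p + r) q s = c%:C%C * ratval p q s + ratval r q s.
Proof. by rewrite /ratval cevalD cevalZ mulrDl mulrA. Qed.

Lemma ratval_taylor q p s : q.[0] != 0 -> ceval q s != 0 ->
  ratval p q s = (tcoef q p)%:C%C + s * ratval (trest q p) q s.
Proof.
move=> q0 qs; rewrite /ratval [in LHS](taylor_step p q0).
by rewrite cevalD cevalZ cevalM cevalX mulrDl mulfK// mulrA.
Qed.

Definition kap (z : R * R) : R := (1 + (z.1 * z.2) ^+ 2)^-1.

(** The point 1 / (x + i / t) for z = (x, t), by a formula that is regular at
    t = 0. *)
Definition inv_point (z : R * R) : R * R := (z.1 * z.2 ^+ 2 * kap z, - (z.2 * kap z)).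

(** The part of - Im (p / q) / t^3 at 1 / (x + i / t) that is continuous at t = 0.
    The last term comes from the first-order coefficient d1, since
    kap / t^2 = 1 / t^2 - x^2 kap. *)
Definition im_regular q p (z : R * R) : R :=
  let n3 := trest q (trest q (trest q p)) in
  let y := z.1 * z.2 in
  2 * z.1 * kap z ^+ 2 * tcoef q (trest q (trest q p))
  - kap z ^+ 3 * ((y ^+ 3 - 3 * y) * ((inv_point z).2 * imQ n3 q (inv_point z))
                  + (1 - 3 * y ^+ 2) * reQ n3 q (inv_point z))
  - z.1 ^+ 2 * kap z * tcoef q (trest q p).

Lemma kap_neq0 z : 1 + (z.1 * z.2) ^+ 2 != 0 :> R.
Proof. by rewrite gt_eqF// ltr_pwDl// sqr_ge0. Qed.

Lemma inv_pointE x t : t != 0 ->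
  (Complex x t^-1)^-1 = Complex (inv_point (x, t)).1 (inv_point (x, t)).2.
Proof.
move=> t0; have k0 := kap_neq0 (x, t); rewrite /= in k0.
have k1 : x ^+ 2 + t^-1 ^+ 2 != 0.
  rewrite gt_eqF// ltr_wpDl ?sqr_ge0// exprn_even_gt0//=.
  by rewrite invr_eq0.
rewrite /inv_point /kap /= -[LHS]/(Complex _ _).
have -> : x ^+ 2 + t^-1 ^+ 2 = (1 + (x * t) ^+ 2) / t ^+ 2 by field.
by congr Complex; field; rewrite k0 t0.
Qed.

(** With the polynomials p and q reversed, this describes the behaviour at infinity:
    the only singular term does not depend on x, so that vertical lines can be
    compared with one another. *)
Lemma Im_expansion q p x t : q.[0] != 0 -> t != 0 ->
  ceval q (Complex x t^-1)^-1 != 0 ->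
  complex.Im (ratval p q (Complex x t^-1)^-1) =
  - t ^+ 3 * (t ^- 2 * tcoef q (trest q p) + im_regular q p (x, t)).
Proof.
move=> q0 t0; rewrite inv_pointE// => qz.
rewrite (ratval_taylor _ q0 qz) (ratval_taylor (trest q p) q0 qz).
rewrite (ratval_taylor (trest q (trest q p)) q0 qz) ratvalE /im_regular /=.
have k0 := kap_neq0 (x, t); rewrite /= in k0.
set I := imQ _ _ _; set A := reQ _ _ _; set d1 := tcoef _ _; set d2 := tcoef _ _.
rewrite /inv_point /kap /=.
by field; rewrite t0 k0.
Qed.

Lemma reQ0 q p : reQ p q (0, 0) = tcoef q p.
Proof.
have /(congr1 (@complex.Re R)) := ratvalE p q 0 0.
by rewrite -[Complex 0 0]/(0%:C%C) /ratval !ceval_real -fmorph_div /= => <-.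
Qed.

Lemma im_regular_continuous q p x : q.[0] != 0 ->
  {for (x, 0), continuous (im_regular q p)}.
Proof.
move=> q0.
have kc : {for (x, 0), continuous kap}.
  apply: cvgV; first exact: kap_neq0.
  apply: cvgD; first exact: cvg_cst.
  under eq_fun do rewrite expr2.
  by apply: cvgM; apply: cvgM; (exact: cvg_fst || exact: cvg_snd).
have z0 : inv_point (x, 0) = (0, 0).
  by rewrite /inv_point /= expr0n /= mulr0 !mul0r oppr0.
have q0' : ceval q (Complex (inv_point (x, 0)).1 (inv_point (x, 0)).2) != 0.
  by rewrite z0 -[Complex _ _]/(0%:C%C) ceval_real eq_complex /= eqxx andbT.
have c2 : {for (x, 0), continuous (fun z : R * R => z.2 * kap z)}.
  by apply: cvgM => //; exact: cvg_snd.
have y1 : {for (x, 0), continuous (fun z : R * R => z.1 * z.2)}.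
  by apply: cvgM; (exact: cvg_fst || exact: cvg_snd).
have zc : {for (x, 0), continuous inv_point}.
  have c1 : {for (x, 0), continuous (fun z : R * R => z.1 * z.2 ^+ 2 * kap z)}.
    apply: cvgM => //; apply: cvgM; first exact: cvg_fst.
    by under eq_fun do rewrite expr2; apply: cvgM; exact: cvg_snd.
  exact: (cvg_pair c1 (cvgN c2)).
have rc p' : {for (x, 0), continuous (fun z => reQ p' q (inv_point z))}.
  by apply: continuous_comp => //; exact: reQ_continuous.
have ic p' : {for (x, 0), continuous (fun z => imQ p' q (inv_point z))}.
  by apply: continuous_comp => //; exact: imQ_continuous.
have mid p' :
    {for (x, 0), continuous (fun z => (inv_point z).2 * imQ p' q (inv_point z))}.
  by apply: cvgM; [exact: (cvgN c2)|exact: ic].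
have X n (f : R * R -> R) : {for (x, 0), continuous f} ->
    {for (x, 0), continuous (fun z => f z ^+ n)}.
  by move=> fc; exact: (continuous_comp fc (@exprn_continuous R n _)).
have Z (f : R * R -> R) c : {for (x, 0), continuous f} ->
    {for (x, 0), continuous (fun z => c * f z)}.
  by move=> fc; apply: cvgM => //; exact: cvg_cst.
have fc : {for (x, 0), continuous (fun z : R * R => z.1)} by exact: cvg_fst.
apply: cvgB; last by apply: cvgM; [apply: cvgM => //; exact: X|exact: cvg_cst].
apply: cvgB.
  apply: cvgM; last exact: cvg_cst.
  by apply: cvgM; [exact: Z|exact: X].
apply: cvgM; first exact: X.
apply: cvgD; apply: cvgM => //.
- by apply: cvgB; [exact: (X 3)|exact: Z].
- exact: mid.
- by apply: cvgB; [exact: cvg_cst|exact: (Z _ _ (X 2 _ y1))].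
- exact: rc.
Qed.

Lemma im_regular0 q p x : im_regular q p (x, 0) =
  2 * x * tcoef q (trest q (trest q p)) - tcoef q (trest q (trest q (trest q p)))
  - x ^+ 2 * tcoef q (trest q p).
Proof.
rewrite /im_regular /inv_point /kap /= !(mulr0, mul0r, expr0n) /= oppr0 addr0 invr1 reQ0.
by ring.
Qed.
End Expansion.

(** * Functions with nonpositive imaginary part: finite points *)

Section ScalarNI.
Context {R : realType}.
Implicit Types (p q r : {poly R}) (s : R[i]) (x t c e : R).

Definition stable e q : Prop := forall s, - e < complex.Re s -> ceval q s != 0.

Definition im_nonpos e p q : Prop := forall s, - e < complex.Re s ->
  0 < complex.Im s -> complex.Im (ratval p q s) <= 0.

Lemma near_affine (a b c : R) : c < a -> \forall t \near (0 : R)^'+, c < a + t * b.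
Proof.
move=> ca.
have /cvgr_gt : (a + t * b) @[t --> (0 : R)^'+] --> a + 0 * b.
  apply: cvg_at_right_filter; apply: cvgD; first exact: cvg_cst.
  by apply: cvgM; [exact: cvg_id|exact: cvg_cst].
by apply; rewrite mul0r addr0.
Qed.

Lemma Re_ray s (w : R[i]) t : complex.Re (s + t%:C%C * w) =
  complex.Re s + t * complex.Re w.
Proof. by case: s w => [a b] [c d] /=; ring. Qed.

Lemma Im_ray s (w : R[i]) t : complex.Im (s + t%:C%C * w) =
  complex.Im s + t * complex.Im w.
Proof. by case: s w => [a b] [c d] /=; ring. Qed.

Lemma Im_cmul c (z : R[i]) : complex.Im (c%:C%C * z) = c * complex.Im z.
Proof. by case: z => a b /=; ring. Qed.

(** The positive imaginary axis is interior to the region, so that a real value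
    there would be an interior maximum of the imaginary part. *)
Lemma im_neg_axis e p q : 0 < e -> stable e q -> im_nonpos e p q ->
  (forall c, p != c *: q) ->
  forall w, 0 < w -> complex.Im (ratval p q (Complex 0 w)) < 0.
Proof.
move=> e0 qe pqe pq w w0; rewrite lt_neqAle pqe ?oppr_lt0// andbT.
apply/eqP => I0; set s := Complex 0 w in I0.
have qs : ceval q s != 0 by apply: qe; rewrite /= oppr_lt0.
have [|w' incr] := @Im_increases _ (map_poly (real_complex R) p) _ _ qs.
  apply/eqP; set z := _ / _ => pE.
  have zE : z = (complex.Re z)%:C%C.
    by move: I0; rewrite /ratval /ceval -/z; case: (z) => a b /= ->.
  move: pE; rewrite zE -map_polyZ => /(map_poly_inj (real_complex R))/eqP.
  exact/negP/pq.
have {incr} : \forall t \near (0 : R)^'+, False.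
  move: incr.
  have eN : - e < 0 by rewrite oppr_lt0.
  apply: filterS3 (near_affine (complex.Re w') eN) (near_affine (complex.Im w') w0).
  move=> t t1 t2; rewrite [X in X < _]I0 ltNge => /negP; apply; apply: pqe.
    by rewrite Re_ray.
  by rewrite Im_ray.
by move/filter_ex => [].
Qed.

Lemma lowest_term q p : q.[0] != 0 -> (forall c, p != c *: q) ->
  exists k r, [/\ (0 < k)%N, r.[0] != 0 & p = tcoef q p *: q + r * 'X^k].
Proof.
move=> q0 pq; have [k [r]] := multiplicity_XsubC (p - tcoef q p *: q) 0.
rewrite subr_eq0 pq rootE /= polyC0 subr0 => r0 /eqP.
rewrite subr_eq addrC => /eqP pE; exists k, r; split => //.
case: k pE => // pE; move: r0 => /negP[].
move/(congr1 (horner^~ 0)): pE; rewrite expr0 mulr1 hornerD hornerZ.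
by rewrite /tcoef divfK// => /eqP; rewrite -subr_eq0 opprD addrA subrr sub0r oppr_eq0.
Qed.

Lemma ray_ratval p q r c k (w : R[i]) : p = c *: q + r * 'X^k ->
  0 < r.[0] / q.[0] * complex.Im (w ^+ k) ->
  \forall t \near (0 : R)^'+, 0 < complex.Im (ratval p q (t%:C%C * w)).
Proof.
move=> pE h; have : 0 < complex.Im (w ^+ k *
    ((map_poly (real_complex R) r).[0] / (map_poly (real_complex R) q).[0])).
  rewrite -[_.[0]]/(ceval r (0%:C)%C) -[X in _ / X]/(ceval q (0%:C)%C) !ceval_real.
  by rewrite -fmorph_div mulrC Im_cmul.
move/ray_test; apply: filterS => t; rewrite add0r => ht.
have pC : map_poly (real_complex R) p = c%:C%C *: map_poly (real_complex R) q
    + map_poly (real_complex R) r * ('X - 0%:P) ^+ k.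
  by rewrite pE rmorphD rmorphM /= map_polyZ map_polyXn polyC0 subr0.
have := ray_value pC (z := t%:C%C * w); rewrite add0r => /(_ ht) h1.
by rewrite /ratval /ceval h1 ImD /= add0r.
Qed.

Lemma imQ00 q p :
  imQ p q (0, 0) = (p`_1 * q`_0 - p`_0 * q`_1) / q`_0 ^+ 2.
Proof.
have reim0 (l : seq R) : reim l (0, 0) = (l`_0, l`_1).
  case: l => [|a [|b l]] //=; first by congr pair; ring.
  case: (reim l (0, 0)) => c d /=.
  by congr pair; ring.
by rewrite /imQ /sqabs !reim0 /= expr0n /= mul0r addr0.
Qed.

(** At 0 the function is conformal with negative derivative: any other
    lowest term would take values with positive imaginary part in the upper
    half-plane. The division by y in imQ makes its value at 0 the derivative. *)
Lemma imQ0_neg e p q : 0 < e -> stable e q -> im_nonpos e p q ->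
  (forall c, p != c *: q) -> imQ p q (0, 0) < 0.
Proof.
move=> e0 qe pqe pq.
have q0 : q.[0] != 0.
  have := qe 0; rewrite -[0]/(0%:C%C) ceval_real /= oppr_lt0 => /(_ e0).
  by rewrite eq_complex /= eqxx andbT.
have [k [r [k0 r0 pE]]] := lowest_term q0 pq.
(* The lowest term may not point upwards along a ray of the upper half-plane. *)
have noray w : 0 < complex.Im w -> ~ 0 < r.[0] / q.[0] * complex.Im (w ^+ k).
  move=> w0 /(ray_ratval pE) h.
  have {h} : \forall t \near (0 : R)^'+, False.
    have eN : - e < 0 by rewrite oppr_lt0.
    apply: filterS3 (nbhs_right_gt 0) (near_affine (complex.Re w) eN) h.
    move=> t t0 t1; rewrite ltNge => /negP; apply; apply: pqe.
      by rewrite -[_ * _]add0r Re_ray.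
    by rewrite -[_ * _]add0r Im_ray /= add0r mulr_gt0.
  by move/filter_ex => [].
have rq0 : r.[0] / q.[0] != 0 by rewrite mulf_neq0// invr_eq0.
have rq : r.[0] / q.[0] < 0.
  rewrite lt_neqAle rq0 leNgt; apply/negP => rq.
  have [w [_ w1 w2]] := direction_pos (R := R) k0.
  by apply: (noray w) => //; rewrite mulr_gt0.
have k1 : k = 1%N.
  apply/eqP; rewrite eqn_leq k0 andbT leqNgt; apply/negP => k1.
  have [w [_ w1 w2]] := direction_neg (R := R) k1.
  by apply: (noray w) => //; rewrite nmulr_rgt0.
suff -> : imQ p q (0, 0) = r.[0] / q.[0] by [].
rewrite imQ00.
have p0E : p`_0 = tcoef q p * q`_0 + r`_0 * 0.
  by rewrite {1}pE k1 coefD coefZ coefMX /= mulr0.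
have p1E : p`_1 = tcoef q p * q`_1 + r`_0.
  by rewrite {1}pE k1 coefD coefZ coefMX.
rewrite p0E p1E; move: q0 r0; rewrite !horner_coef0 => q0 r0.
by field.
Qed.

End ScalarNI.

(** * Functions with nonpositive imaginary part: infinity *)

Section AtInfinity.
Context {R : realType}.
Implicit Types (p q r : {poly R}) (s : R[i]) (x t c e : R).

Lemma revpK n p : (size p <= n.+1)%N -> revp n (revp n p) = p.
Proof.
move=> pn; apply/polyP => i; rewrite coef_poly; case: ltnP => [ilt|ige].
  by rewrite coef_poly ltnS leq_subr subKn.
by rewrite nth_default// (leq_trans pn).
Qed.

Lemma revp_linear n c p r : revp n (c *: p + r) = c *: revp n p + revp n r.
Proof.
apply/polyP => i; rewrite coefD coefZ !coef_poly; case: ifP => _.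
  by rewrite coefD coefZ.
by rewrite mulr0 addr0.
Qed.

Lemma revpZ n c p : revp n (c *: p) = c *: revp n p.
Proof.
apply/polyP => i; rewrite coefZ !coef_poly; case: ifP => _.
  by rewrite coefZ.
by rewrite mulr0.
Qed.

Lemma ReIm_inv_gt0 (z : R[i]) : 0 < complex.Re z -> complex.Im z < 0 ->
  0 < complex.Re z^-1 /\ 0 < complex.Im z^-1.
Proof.
case: z => a b /= a0 b0.
have n0 : 0 < (a ^+ 2 + b ^+ 2)^-1.
  by rewrite invr_gt0 ltr_pwDl ?exprn_gt0// sqr_ge0.
by rewrite -mulNr !mulr_gt0// oppr_gt0.
Qed.

(** In the variable 1 / s the first quadrant becomes the fourth one, an angle of
    pi / 2: this leaves room for terms of order 1 and 2 only, with positive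
    coefficient. *)
Lemma tcoef_infinity e n p q : 0 < e -> im_nonpos e p q ->
  (forall c, p != c *: q) -> (size p <= n.+1)%N -> (size q <= n.+1)%N ->
  q`_n != 0 ->
  let ph := revp n p in let qh := revp n q in
  0 <= tcoef qh (trest qh ph) /\
  (tcoef qh (trest qh ph) = 0 -> 0 < tcoef qh (trest qh (trest qh ph))).
Proof.
move=> e0 pqe pq pn qn qn0 ph qh.
have q0 : qh.[0] != 0 by rewrite revp0.
have pqh c : ph != c *: qh.
  by apply/eqP => /(congr1 (revp n)); rewrite revpZ !revpK//; exact/eqP/pq.
have [k [r [k0 r0 pE]]] := lowest_term q0 pqh.
have noray w : 0 < complex.Re w -> complex.Im w < 0 ->
    ~ 0 < r.[0] / qh.[0] * complex.Im (w ^+ k).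
  move=> w0 w1 /(ray_ratval pE) h.
  have {h} : \forall t \near (0 : R)^'+, False.
    apply: filterS2 (nbhs_right_gt 0) h => t t0.
    have [] := @ReIm_inv_gt0 (t%:C%C * w).
    - by rewrite -[_ * _]add0r Re_ray /= add0r mulr_gt0.
    - by rewrite -[_ * _]add0r Im_ray /= add0r pmulr_rlt0.
    move=> z0 z1; rewrite ltNge => /negP; apply.
    have zN0 : (t%:C%C * w)^-1 != 0.
      by apply/eqP => z00; move: z0; rewrite z00 ltxx.
    have := ratval_inv pn qn zN0; rewrite invrK => <-; apply: pqe => //.
    by apply: lt_trans z0; rewrite oppr_lt0.
  by move/filter_ex => [].
have ImJ (w : R[i]) : complex.Im (w^*%C ^+ k) = - complex.Im (w ^+ k).
  by rewrite -rmorphXn; case: (w ^+ k).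
have rq0 : r.[0] / qh.[0] != 0 by rewrite mulf_neq0// invr_eq0.
have rq : 0 < r.[0] / qh.[0].
  rewrite lt_neqAle eq_sym rq0 leNgt; apply/negP => rq.
  have [w [w0 w1 w2]] := direction_pos (R := R) k0.
  apply: (noray w^*%C); first by case: w w0 {w1 w2}.
    by case: w w1 {w0 w2} => a b /=; rewrite oppr_lt0.
  by rewrite ImJ nmulr_rgt0// oppr_lt0.
have k2 : (k <= 2)%N.
  rewrite leqNgt; apply/negP => k2.
  have [w [w0 w1 w2]] := direction_neg (R := R) (ltnW k2).
  apply: (noray w^*%C); first by case: w w0 {w1 w2} => a b; apply.
    by case: w w1 {w0 w2} => a b /=; rewrite oppr_lt0.
  by rewrite ImJ mulr_gt0// oppr_gt0.
have trE : trest qh ph = r * 'X^(k.-1).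
  have X0 : ('X : {poly R}) != 0 by rewrite polyX_eq0.
  apply: (mulfI X0); have := taylor_step ph q0; rewrite {1}pE => /addrI <-.
  by rewrite mulrCA -exprS prednK.
move: k2; rewrite leq_eqVlt => /orP[/eqP k2|].
  have d1 : tcoef qh (trest qh ph) = 0.
    by rewrite trE k2 /tcoef hornerM hornerX mulr0 mul0r.
  split=> [|_]; first by rewrite d1.
  have X0 : ('X : {poly R}) != 0 by rewrite polyX_eq0.
  suff -> : trest qh (trest qh ph) = r by [].
  apply: (mulfI X0); have := taylor_step (trest qh ph) q0.
  by rewrite d1 scale0r add0r => <-; rewrite trE k2 mulrC.
rewrite ltnS => k1.
have -> : tcoef qh (trest qh ph) = r.[0] / qh.[0].
  rewrite trE (_ : k.-1 = 0%N) ?expr0 ?mulr1//.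
  by move: k0 k1; case: (k) => [|[]].
by split; [exact: ltW|move=> h; move: rq0; rewrite h eqxx].
Qed.

(** Where the terms of order 1 vanish, the term of order 2 turns the strict
    stability margin into a strict sign for the term of order 3: this is
    where lines to the left of the imaginary axis are used. *)
Lemma im_regular_infinity e n p q : 0 < e -> stable e q -> im_nonpos e p q ->
  (forall c, p != c *: q) -> (size p <= n.+1)%N -> (size q <= n.+1)%N ->
  q`_n != 0 -> tcoef (revp n q) (trest (revp n q) (revp n p)) = 0 ->
  0 < im_regular (revp n q) (revp n p) (0, 0).
Proof.
move=> e0 qe pqe pq pn qn qn0 d1.
have q0 : (revp n q).[0] != 0 by rewrite revp0.
have [_ /(_ d1) d2] := tcoef_infinity e0 pqe pq pn qn qn0.
pose x := - e / 2.
have xe : - e < x by rewrite /x; lra.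
have x0 : x < 0 by rewrite /x; lra.
have : 0 <= im_regular (revp n q) (revp n p) (x, 0).
  have /cvgr_to_ge : im_regular (revp n q) (revp n p) (x, t) @[t --> (0 : R)^'+] -->
      im_regular (revp n q) (revp n p) (x, 0).
    apply: cvg_at_right_filter.
    have ct : (x, t) @[t --> (0 : R)] --> (x, (0 : R)).
      exact: (cvg_pair (cvg_cst x) cvg_id).
    exact: (cvg_comp _ _ ct (@im_regular_continuous _ _ (revp n p) x q0)).
  apply; move: (nbhs_right_gt (0 : R)); apply: filterS => t t0.
  have tN0 : t != 0 by rewrite gt_eqF.
  have s0 : Complex x t^-1 != 0.
    by rewrite eq_complex negb_and /= invr_eq0 tN0 orbT.
  have qs : ceval q (Complex x t^-1) != 0 by exact: qe.
  have /= := pqe (Complex x t^-1) xe; rewrite invr_gt0 => /(_ t0).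
  rewrite (ratval_inv pn qn s0) Im_expansion//; last exact: revp_neq0.
  by rewrite d1 mulr0 add0r mulNr oppr_le0 pmulr_rge0// exprn_gt0.
rewrite !im_regular0 d1 !mulr0 !subr0 mul0r sub0r => h.
by have : x * tcoef (revp n q) (trest (revp n q) (trest (revp n q) (revp n p))) < 0;
  [rewrite nmulr_rlt0|lra].
Qed.

End AtInfinity.

(** * Necessary conditions for matrices *)

Lemma near_rightP {R : realType} (P : R -> Prop) :
  (\forall t \near (0 : R)^'+, P t) ->
  exists2 d, 0 < d & forall t, 0 < t -> t < d -> P t.
Proof.
move=> /nbhs_ballP[d /= d0 h]; exists d => // t t0 td; apply: h => //=.
by rewrite /ball /= sub0r normrN gtr0_norm.
Qed.

Section MatrixNI.
Context {R : realType} {m : nat}.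
Implicit Types (p q r : {poly R}) (s : R[i]) (x t c e : R) (u : 'rV[R]_m)
  (N : 'M[{poly R}]_m).

Definition numform N u : {poly R} := \sum_i \sum_j (u 0 i * u 0 j) *: N i j.

(** Relates a coefficient in an expansion of the matrix to the same coefficient
    for the scalar function attached to u. *)
Lemma linear_numform (V : lmodType R) (f : {poly R} -> V) N u :
  (forall c p r, f (c *: p + r) = c *: f p + f r) ->
  f (numform N u) = \sum_i \sum_j (u 0 i * u 0 j) *: f (N i j).
Proof.
move=> fl.
have f0 : f 0 = 0.
  by have := fl (-1) 0 0; rewrite scaleN1r oppr0 addr0 scaleN1r addNr.
have fD p r : f (p + r) = f p + f r by rewrite -[p]scale1r fl !scale1r.
have fZ c p : f (c *: p) = c *: f p by rewrite -[_ *: p]addr0 fl f0 addr0.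
rewrite /numform (big_morph f fD f0); apply: eq_bigr => i _.
by rewrite (big_morph f fD f0); apply: eq_bigr => j _; rewrite fZ.
Qed.

Lemma qform_linear (f : {poly R} -> R) N u :
  (forall c p r, f (c *: p + r) = c * f p + f r) ->
  qform (\matrix_(i, j) f (N i j)) u = f (numform N u).
Proof.
move=> fl; rewrite (@linear_numform R^o f N u fl); apply: eq_bigr => i _.
by apply: eq_bigr => j _; rewrite mxE -mulrA mulrC.
Qed.

(** The real symmetric matrix i (G - G^H), H denoting the conjugate transpose, of
    the symmetric G = N / q. *)
Definition nimx N q s : 'M[R]_m :=
  \matrix_(i, j) (-2 * complex.Im (ratval (N i j) q s)).

(** The previous matrix divided by the imaginary part of the point z.1 + i z.2,
    defined on the real axis too. *)
Definition nimx_quot N q z : 'M[R]_m := \matrix_(i, j) (-2 * imQ (N i j) q z).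

(** The expansion of the matrix at x + i / t is 2 t^3 (D / t^2 + E), with D
    and E the next two matrices and E continuous at t = 0. *)
Definition nimx_order1 n N q : 'M[R]_m :=
  \matrix_(i, j) tcoef (revp n q) (trest (revp n q) (revp n (N i j))).
Definition nimx_regular n N q z : 'M[R]_m :=
  \matrix_(i, j) im_regular (revp n q) (revp n (N i j)) z.

Lemma qform_nimx N q s u :
  qform (nimx N q s) u = -2 * complex.Im (ratval (numform N u) q s).
Proof.
rewrite /nimx (@qform_linear (fun p => -2 * complex.Im (ratval p q s)))//.
by move=> c p r; rewrite ratval_linear ImD Im_cmul; ring.
Qed.

Lemma qform_nimx_quot0 N q u :
  qform (nimx_quot N q (0, 0)) u = -2 * imQ (numform N u) q (0, 0).
Proof.
rewrite /nimx_quot (@qform_linear (fun p => -2 * imQ p q (0, 0)))//.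
by move=> c p r; rewrite !imQ00 !coefD !coefZ; ring.
Qed.

Lemma qform_nimx_order1 n N q u :
  qform (nimx_order1 n N q) u =
  tcoef (revp n q) (trest (revp n q) (revp n (numform N u))).
Proof.
rewrite /nimx_order1.
rewrite (@qform_linear (fun p => tcoef (revp n q) (trest (revp n q) (revp n p))))//.
by move=> c p r; rewrite revp_linear trest_linear tcoef_linear.
Qed.

Lemma qform_nimx_regular0 n N q u :
  qform (nimx_regular n N q (0, 0)) u =
  im_regular (revp n q) (revp n (numform N u)) (0, 0).
Proof.
rewrite /nimx_regular.
rewrite (@qform_linear (fun p => im_regular (revp n q) (revp n p) (0, 0)))//.
by move=> c p r; rewrite !im_regular0 revp_linear !trest_linear !tcoef_linear; ring.
Qed.

Lemma size_numform N u k : (forall i j, (size (N i j) <= k)%N) ->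
  (size (numform N u) <= k)%N.
Proof.
move=> Nk; apply: (leq_trans (size_sum _ _ _)); apply/bigmax_leqP => i _.
apply: (leq_trans (size_sum _ _ _)); apply/bigmax_leqP => j _.
exact: leq_trans (size_scale_leq _ _) (Nk i j).
Qed.

Lemma nimx_quotE N q x t : nimx N q (Complex x t) = t *: nimx_quot N q (x, t).
Proof. by apply/matrixP => i j; rewrite !mxE ratvalE /=; ring. Qed.

Lemma nimx_infinity n N q x t : (forall i j, (size (N i j) <= n.+1)%N) ->
  (size q <= n.+1)%N -> q`_n != 0 -> t != 0 -> ceval q (Complex x t^-1) != 0 ->
  nimx N q (Complex x t^-1) =
  (2 * t ^+ 3) *: (t ^- 2 *: nimx_order1 n N q + nimx_regular n N q (x, t)).
Proof.
move=> Nn qn qn0 tN0 qs; apply/matrixP => i j; rewrite !mxE.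
have s0 : Complex x t^-1 != 0.
  by rewrite eq_complex negb_and /= invr_eq0 tN0 orbT.
rewrite (ratval_inv (Nn i j) qn s0) Im_expansion ?revp0//; last exact: revp_neq0.
by ring.
Qed.

Lemma nimx_regular_continuous n N q x i j : q`_n != 0 ->
  {for (x, 0), continuous (fun z => nimx_regular n N q z i j)}.
Proof.
move=> qn0; have -> : (fun z => nimx_regular n N q z i j) =
    im_regular (revp n q) (revp n (N i j)).
  by apply/funext => z; rewrite mxE.
by apply: im_regular_continuous; rewrite revp0.
Qed.

Lemma nimx_quot_continuous N q z i j : ceval q (Complex z.1 z.2) != 0 ->
  {for z, continuous (fun z => nimx_quot N q z i j)}.
Proof.
move=> qz; have -> : (fun z => nimx_quot N q z i j) = (fun z => -2 * imQ (N i j) q z).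
  by apply/funext => z'; rewrite mxE.
by apply: cvgM; [exact: cvg_cst|exact: imQ_continuous].
Qed.

(** The scalar results apply to each vector u separately. Finsler's lemma makes
    the condition at infinity uniform in u: some k D + E(0, 0) is positive definite,
    and k <= 1 / t^2 for t small. *)
Lemma ni_necessary e n N q : 0 < e -> stable e q ->
  (forall s, - e < complex.Re s -> 0 < complex.Im s ->
    forall u, 0 <= qform (nimx N q s) u) ->
  (forall u, u != 0 -> forall c, numform N u != c *: q) ->
  (forall i j, (size (N i j) <= n.+1)%N) -> (size q <= n.+1)%N -> q`_n != 0 ->
  [/\ forall w, 0 < w -> posdef (nimx N q (Complex 0 w)),
      exists c d, [/\ 0 < c, 0 < d & forall w, d <= w ->
        forall u, c * sqnorm u <= qform (w ^+ 3 *: nimx N q (Complex 0 w)) u]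
    & posdef (nimx_quot N q (0, 0))].
Proof.
move=> e0 qe Pe Nq Nn qn qn0.
have im_u u : im_nonpos e (numform N u) q.
  by move=> s s1 s2; have := Pe s s1 s2 u; rewrite qform_nimx; lra.
split.
- move=> w w0 u u0; rewrite qform_nimx.
  by have := im_neg_axis e0 qe (im_u u) (Nq u u0) w0; lra.
- have [k kP] : exists k : nat,
      posdef (k%:R *: nimx_order1 n N q + nimx_regular n N q (0, 0)).
    apply: finsler => u; rewrite ?qform_nimx_order1 ?qform_nimx_regular0.
      have [->|u0] := eqVneq u 0.
        by rewrite -qform_nimx_order1 qform0.
      by have [] := tcoef_infinity e0 (im_u u) (Nq u u0) (size_numform u Nn) qn qn0.
    move=> u0 d1.
    exact: (im_regular_infinity e0 qe (im_u u) (Nq u u0) (size_numform u Nn) qn qn0).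
  have [c c0 cP] := posdef_coercive kP.
  (* Half of the coercivity constant is left for the variation of E near t = 0. *)
  have kP2 : posdef (k%:R *: nimx_order1 n N q +
      nimx_regular n N q (0, 0) - (c / 2)%:M).
    move=> u u0; rewrite qformB -[(c / 2)%:M]scalemx1 qformZ qform1.
    by have := cP u; have := sqnorm_gt0 u0; nra.
  have : \forall t \near (0 : R)^'+,
      posdef (k%:R *: nimx_order1 n N q + nimx_regular n N q (0, t) - (c / 2)%:M).
    apply: posdef_near kP2 => i j.
    have -> : (fun t => (k%:R *: nimx_order1 n N q +
        nimx_regular n N q (0, t) - (c / 2)%:M) i j) =
      (fun t => k%:R * nimx_order1 n N q i j +
        nimx_regular n N q (0, t) i j - (c / 2)%:M i j).
      by apply/funext => t; rewrite !mxE.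
    rewrite !mxE; apply: cvgB; last exact: cvg_cst.
    apply: cvgD; first exact: cvg_cst.
    apply: cvg_at_right_filter.
    have ct : ((0 : R), t) @[t --> (0 : R)] --> ((0 : R), (0 : R)).
      exact: (cvg_pair (cvg_cst (0 : R)) cvg_id).
    have := cvg_comp _ _ ct (@nimx_regular_continuous n N q 0 i j qn0).
    by rewrite !mxE.
  move=> /near_rightP[d d0 dP].
  exists c, ((k%:R + 1) + 2 / d); split => //.
    have := ler0n R k; have : 0 < 2 / d by rewrite divr_gt0.
    by lra.
  move=> w wd u.
  have k0 := ler0n R k.
  have d2 : 0 < 2 / d by rewrite divr_gt0.
  have w0 : 0 < w by lra.
  have wi0 : 0 < w^-1 by rewrite invr_gt0.
  have wid : w^-1 < d.
    rewrite invf_plt ?posrE//; apply: lt_le_trans wd.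
    have : 0 < d^-1 by rewrite invr_gt0.
    by lra.
  have [->|u0] := eqVneq u 0.
    by rewrite qform0 sqnorm0 mulr0.
  have := dP _ wi0 wid u u0.
  rewrite qformB -[(c / 2)%:M]scalemx1 qformZ qform1 qformD qformZ => h.
  have wiN0 : w^-1 != 0 by rewrite gt_eqF.
  have qw : ceval q (Complex 0 w^-1^-1) != 0 by apply: qe; rewrite /= oppr_lt0.
  have := nimx_infinity Nn qn qn0 wiN0 qw; rewrite invrK => ->.
  rewrite !qformZ qformD qformZ -exprVn invrK.
  have D0 : 0 <= qform (nimx_order1 n N q) u.
    rewrite qform_nimx_order1.
    by have [] := tcoef_infinity e0 (im_u u) (Nq u u0) (size_numform u Nn) qn qn0.
  have kw : k%:R <= w ^+ 2 by nra.
  have -> (z : R) : w ^+ 3 * (2 * w^-1 ^+ 3 * z) = 2 * z.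
    by field; rewrite gt_eqF.
  have : k%:R * qform (nimx_order1 n N q) u <= w ^+ 2 * qform (nimx_order1 n N q) u.
    exact: ler_wpM2r.
  by lra.
- move=> u u0; rewrite qform_nimx_quot0.
  by have := imQ0_neg e0 qe (im_u u) (Nq u u0); lra.
Qed.

End MatrixNI.

(** * Maximum principle *)

Section Sufficiency.
Context {R : realType}.
Implicit Types (p q r : {poly R}) (s : R[i]) (x y t c e : R).

Lemma near_boxP (a b : R) (P : R * R -> Prop) :
  (\forall z \near (a, b), P z) ->
  exists2 d, 0 < d & forall x y, `|x - a| < d -> `|y - b| < d -> P (x, y).
Proof.
move=> /nbhs_ballP[d /= d0 h]; exists d => // x y xa yb; apply: h.
by split; rewrite /= /ball /= distrC.
Qed.

(** A real proper rational function has a real limit at infinity. *)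
Lemma im_decay n p q c : (size p <= n.+1)%N -> (size q <= n.+1)%N ->
  q`_n != 0 -> 0 < c ->
  exists2 rho, 0 < rho & forall x y, rho < `|x| \/ rho < `|y| ->
    complex.Im (ratval p q (Complex x y)) < c.
Proof.
move=> pn qn qn0 c0.
pose f (z : R * R) := z.2 * imQ (revp n p) (revp n q) z.
have fc : {for (0, 0), continuous f}.
  apply: cvgM; first exact: cvg_snd.
  apply: imQ_continuous; rewrite /= -[Complex 0 0]/(0%:C%C) ceval_real revp0.
  by rewrite eq_complex /= eqxx andbT.
have : \forall z \near ((0 : R), (0 : R)), f z < c.
  by apply: (cvgr_lt (f (0, 0)) fc); rewrite /f /= mul0r.
move=> /near_boxP[d d0 dP].
have di0 : 0 < d^-1 by rewrite invr_gt0.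
exists d^-1 => // x y xy.
have dn : d^-1 ^+ 2 < x ^+ 2 + y ^+ 2.
  have lt2 z : d^-1 < `|z| -> d^-1 ^+ 2 < z ^+ 2.
    by move=> h; rewrite -(real_normK (num_real z)) ltr_pXn2r// nnegrE ltW.
  have [x2 y2] := (sqr_ge0 x, sqr_ge0 y).
  by case: xy => /lt2; lra.
have n0 : 0 < x ^+ 2 + y ^+ 2 by apply: le_lt_trans dn; exact: sqr_ge0.
have s0 : Complex x y != 0.
  rewrite eq_complex /=; apply/negP => /andP[/eqP x0 /eqP y0].
  by move: n0; rewrite x0 y0 expr0n /= addr0 ltxx.
rewrite (ratval_inv pn qn s0) -[_^-1]/(Complex _ _) ratvalE /=.
rewrite -[_ * _]/(f (_, _)).
have small z : z ^+ 2 <= x ^+ 2 + y ^+ 2 -> `|z / (x ^+ 2 + y ^+ 2)| < d.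
  move=> zn; rewrite normrM normfV (gtr0_norm n0) ltr_pdivrMr//.
  rewrite -(@ltr_pXn2r _ 2)// ?nnegrE ?normr_ge0// ?mulr_ge0 ?ltW//.
  rewrite real_normK ?num_real//; apply: (le_lt_trans zn).
  rewrite exprMn [X in _ * X]expr2 mulrA -[ltLHS]mul1r ltr_pM2r//.
  have -> : 1 = d ^+ 2 * d^-1 ^+ 2 by rewrite -exprMn mulfV ?expr1n// gt_eqF.
  by rewrite ltr_pM2l// exprn_gt0.
apply: dP; rewrite subr0.
  by apply: small; rewrite lerDl sqr_ge0.
by rewrite normrN; apply: small; rewrite lerDr sqr_ge0.
Qed.

(** Maximum principle for the harmonic function Im (p / q) on the quadrant
    Re s > - e, Im s > 0. It vanishes on the real axis and at infinity, so a
    positive value would produce an interior maximum, against the open mapping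
    property. *)
Lemma maximum_principle e n p q : 0 < e ->
  (forall s, - e <= complex.Re s -> ceval q s != 0) ->
  (size p <= n.+1)%N -> (size q <= n.+1)%N -> q`_n != 0 ->
  (forall y, 0 < y -> complex.Im (ratval p q (Complex (- e) y)) <= 0) ->
  im_nonpos e p q.
Proof.
move=> e0 qe pn qn qn0 pe s1 s1x s1y.
rewrite leNgt; apply/negP => h1.
pose h (z : R * R) := z.2 * imQ p q z.
have hE x y : complex.Im (ratval p q (Complex x y)) = h (x, y) by rewrite ratvalE.
have s1E : s1 = Complex (complex.Re s1) (complex.Im s1) by case: (s1).
rewrite s1E hE in h1.
have [rho0 rho00 decay] := im_decay pn qn qn0 h1.
pose rho := rho0 + `|complex.Re s1| + `|complex.Im s1|.
have [n1 n2] : 0 <= `|complex.Re s1| /\ 0 <= `|complex.Im s1| by split.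
have [m1 m2] : complex.Re s1 <= `|complex.Re s1| /\
    complex.Im s1 <= `|complex.Im s1|.
  by split; exact: ler_norm.
pose box : set (R * R) := `[- e, rho] `*` `[0, rho].
have box1 : box (complex.Re s1, complex.Im s1).
  by split; rewrite /= in_itv /= /rho; apply/andP; split; lra.
have boxc : compact box by apply: compact_setX; exact: segment_compact.
have hc : {within box, continuous h}.
  apply: continuous_in_subspaceT => z /set_mem[/= z1 _].
  apply: cvgM; first exact: cvg_snd.
  apply: imQ_continuous; apply: qe => /=.
  by move: z1; rewrite in_itv /= => /andP[].
have [|c /set_mem[cx cy] cmax] := compact_EVT_max _ boxc hc.
  by exists (complex.Re s1, complex.Im s1).
rewrite /= !in_itv /= in cx cy.
have hc0 : 0 < h c by apply: (lt_le_trans h1); apply: cmax; exact/mem_set.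
have {}cmax x y : - e <= x -> 0 <= y -> h (x, y) <= h c.
  move=> xe y0; have [zb|] := pselect (box (x, y)).
    by apply: cmax; exact/mem_set.
  move=> zb; apply: le_trans (cmax _ (mem_set box1)); rewrite -hE ltW//.
  apply: decay; have [xr|xr] := ltP rho0 `|x|; first by left.
  have [yr|yr] := ltP rho0 `|y|; first by right.
  exfalso; apply: zb; have := ler_norm x; have := ler_norm y => h3 h4.
  by split; rewrite /= in_itv /= /rho; apply/andP; split; lra.
case: c cx cy hc0 cmax => cx cy /= /andP[cx1 cx2] /andP[cy1 cy2] hc0 cmax.
have cy0 : 0 < cy.
  rewrite lt_neqAle cy1 andbT; apply/eqP => cy0.
  by move: hc0; rewrite /h -cy0 /= mul0r ltxx.
have cxe : - e < cx.
  rewrite lt_neqAle cx1 andbT; apply/eqP => cxe.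
  by have := pe _ cy0; rewrite hE cxe => /le_lt_trans/(_ hc0); rewrite ltxx.
have qs : ceval q (Complex cx cy) != 0 by exact: qe.
have [|w incr] := @Im_increases _ (map_poly (real_complex R) p) _ _ qs.
  apply/eqP; set z := _ / _ => pE.
  have zI : complex.Im z = h (cx, cy) by rewrite -hE.
  have q0 : ceval q 0%:C%C != 0 by apply: qe; rewrite /= oppr_le0 ltW.
  move: hc0; rewrite -zI.
  have -> : z = ratval p q 0%:C%C.
    by rewrite /ratval [ceval p _]/ceval pE hornerZ mulfK.
  by rewrite /ratval !ceval_real -fmorph_div /= ltxx.
have {incr} : \forall t \near (0 : R)^'+, False.
  move: incr.
  apply: filterS3 (near_affine (complex.Re w) cxe) (near_affine (complex.Im w) cy0).
  move=> t t1 t2; rewrite ltNge => /negP; apply.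
  change (complex.Im (ratval p q (Complex cx cy + t%:C%C * w)) <=
          complex.Im (ratval p q (Complex cx cy))).
  have -> : Complex cx cy + t%:C%C * w =
      Complex (cx + t * complex.Re w) (cy + t * complex.Im w).
    by case: (w) => w1 w2 /=; rewrite -[LHS]/(Complex _ _); congr Complex; ring.
  by rewrite !hE; apply: cmax; exact: ltW.
by move/filter_ex => [].
Qed.

End Sufficiency.

(** * Sufficient conditions for matrices *)

Section MatrixSufficiency.
Context {R : realType} {m : nat}.
Implicit Types (q : {poly R}) (s : R[i]) (x t c e : R) (u : 'rV[R]_m)
  (N : 'M[{poly R}]_m).

(** Near infinity, moving from the imaginary axis to a nearby vertical line
    leaves the singular term D / t^2 unchanged and perturbs only the continuous
    term E, so that the bound assumed on the axis survives. *)
Lemma posdef_near_infinity e0 n N q c d : 0 < e0 -> stable e0 q ->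
  (forall i j, (size (N i j) <= n.+1)%N) -> (size q <= n.+1)%N -> q`_n != 0 ->
  0 < c -> 0 < d ->
  (forall w, d <= w -> forall u,
    c * sqnorm u <= qform (w ^+ 3 *: nimx N q (Complex 0 w)) u) ->
  exists2 b, 0 < b & forall x w, `|x| < b -> b^-1 < w ->
    posdef (nimx N q (Complex x w)).
Proof.
move=> e00 qe Nn qn qn0 c0 d0 hc.
pose M (z : R * R) := nimx_regular n N q z - nimx_regular n N q (0, z.2) + (c / 4)%:M.
have M0 : posdef ((c / 4)%:M : 'M[R]_m).
  by move=> u u0; rewrite -scalemx1 qformZ qform1 mulr_gt0 ?sqnorm_gt0// divr_gt0.
have : \forall z \near ((0 : R), (0 : R)), posdef (M z).
  apply: (@posdef_near _ _ _ (nbhs ((0 : R), (0 : R))) _ M _ _ M0) => i j.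
  have -> : (fun z => M z i j) = (fun z => nimx_regular n N q z i j -
      nimx_regular n N q (0, z.2) i j + (c / 4)%:M i j).
    by apply/funext => z; rewrite !mxE.
  rewrite -[X in _ --> X]add0r; apply: cvgD; last exact: cvg_cst.
  rewrite -[X in _ --> X](subrr (nimx_regular n N q (0, 0) i j)); apply: cvgB.
    exact: (@nimx_regular_continuous _ _ n N q 0 i j qn0).
  have ct : ((0 : R), z.2) @[z --> ((0 : R), (0 : R))] --> ((0 : R), (0 : R)).
    exact: (cvg_pair (cvg_cst (0 : R)) cvg_snd).
  exact: (cvg_comp _ _ ct (@nimx_regular_continuous _ _ n N q 0 i j qn0)).
move=> /near_boxP[b0 b00 bP].
pose b := Num.min (Num.min b0 e0) d^-1.
have bb : [/\ b <= b0, b <= e0 & b <= d^-1] by rewrite /b !ge_min !lexx ?orbT.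
have [b1 b2 b3] := bb.
have bpos : 0 < b by rewrite !lt_min b00 e00 invr_gt0.
exists b => // x w xb wb.
have bi0 : 0 < b^-1 by rewrite invr_gt0.
have w0 : 0 < w by lra.
have wi0 : 0 < w^-1 by rewrite invr_gt0.
have wib : w^-1 < b by rewrite invf_plt ?posrE.
have wN : w^-1 != 0 by rewrite gt_eqF.
have xe : - e0 < x by move: xb; rewrite ltr_norml => /andP[]; lra.
have qx : ceval q (Complex x w^-1^-1) != 0 by exact: qe.
have q0 : ceval q (Complex 0 w^-1^-1) != 0 by apply: qe; rewrite /= oppr_lt0.
have := nimx_infinity Nn qn qn0 wN qx; rewrite invrK => -> u u0.
have hM : posdef (M (x, w^-1)).
  by apply: bP; rewrite subr0 ?(gtr0_norm wi0); apply: lt_le_trans b1.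
have := hM u u0.
rewrite /M /= !qformD qformN -[(c / 4)%:M]scalemx1 !qformZ qform1 qformD qformZ => h.
have dw : d <= w.
  have : w^-1 < d^-1 by lra.
  by rewrite ltf_pV2 ?posrE// => /ltW.
have := hc w dw u.
have := nimx_infinity Nn qn qn0 wN q0; rewrite invrK => ->.
rewrite !qformZ qformD qformZ.
have -> (z : R) : w ^+ 3 * (2 * w^-1 ^+ 3 * z) = 2 * z.
  by field; rewrite gt_eqF.
move=> h2; have := sqnorm_gt0 u0 => nu; have : 0 < c * sqnorm u by rewrite mulr_gt0.
by move=> h3; rewrite mulr_gt0 ?mulr_gt0 ?exprn_gt0//; lra.
Qed.

(** On a compact part of the imaginary axis, the origin included, positivity of
    P (x + i w) / w is an open condition. *)
Lemma posdef_near_compact e0 N q M : 0 < e0 -> stable e0 q ->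
  (forall w, 0 < w -> posdef (nimx N q (Complex 0 w))) ->
  posdef (nimx_quot N q (0, 0)) ->
  exists2 b, 0 < b & forall x w, `|x| < b -> 0 < w -> w <= M ->
    posdef (nimx N q (Complex x w)).
Proof.
move=> e00 qe Pw K0.
have Kw w : 0 <= w -> posdef (nimx_quot N q (0, w)).
  rewrite le_eqVlt => /orP[/eqP <-//|w0] u u0.
  by have := Pw w w0 u u0; rewrite nimx_quotE qformZ pmulr_rgt0.
have := (compact_near_coveringP `[0, M]%classic).1 (@segment_compact _ 0 M).
move=> /(_ R (nbhs (0 : R)) (fun x w => posdef (nimx_quot N q (x, w))) _).
case=> [w|b /= b0 bP].
  rewrite /= in_itv /= => /andP[w0 _].
  have : \forall z \near ((0 : R), w), posdef (nimx_quot N q z).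
    apply: (@posdef_near _ _ _ (nbhs ((0 : R), w)) _ (nimx_quot N q) _ _ (Kw w w0)).
    move=> i j; apply: nimx_quot_continuous.
    by apply: qe; rewrite /= oppr_lt0.
  have ct : (z.2, z.1) @[z --> (w, (0 : R))] --> ((0 : R), w).
    exact: (cvg_pair cvg_snd cvg_fst).
  by move/ct.
exists b => // x w xb w0 wM u u0.
have : posdef (nimx_quot N q (x, w)).
  apply: (bP x); first by rewrite /= sub0r normrN.
  by rewrite /= in_itv /= wM ltW.
by move=> /(_ u u0); rewrite nimx_quotE qformZ pmulr_rgt0.
Qed.

Lemma ni_sufficient e0 n N q : 0 < e0 -> stable e0 q ->
  (forall i j, (size (N i j) <= n.+1)%N) -> (size q <= n.+1)%N -> q`_n != 0 ->
  (forall w, 0 < w -> posdef (nimx N q (Complex 0 w))) ->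
  (exists c d, [/\ 0 < c, 0 < d & forall w, d <= w -> forall u,
    c * sqnorm u <= qform (w ^+ 3 *: nimx N q (Complex 0 w)) u]) ->
  posdef (nimx_quot N q (0, 0)) ->
  exists e, [/\ 0 < e, e <= e0 & forall s, - e < complex.Re s ->
    0 < complex.Im s -> forall u, 0 <= qform (nimx N q s) u].
Proof.
move=> e00 qe Nn qn qn0 Pw [c [d [c0 d0 hc]]] K0.
have [b b0 bP] := posdef_near_infinity e00 qe Nn qn qn0 c0 d0 hc.
have [a a0 aP] := posdef_near_compact b^-1 e00 qe Pw K0.
(* The division by 2 keeps the closed half-plane Re s >= - e free of poles. *)
pose e := Num.min (Num.min a b) e0 / 2.
have m0 : 0 < Num.min (Num.min a b) e0 by rewrite !lt_min a0 b0.
have [ma mb me] : [/\ Num.min (Num.min a b) e0 <= a,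
    Num.min (Num.min a b) e0 <= b & Num.min (Num.min a b) e0 <= e0].
  by rewrite !ge_min !lexx ?orbT.
have ee : [/\ 0 < e, e < a, e < b & e < e0] by rewrite /e; split; lra.
case: ee => e1 e2 e3 e4.
exists e; split => //; first exact: ltW.
move=> s s1 s2 u; rewrite qform_nimx.
suff : im_nonpos e (numform N u) q by move=> /(_ s s1 s2); lra.
apply: (maximum_principle e1 _ (size_numform u Nn) qn qn0).
  by move=> s' s'e; apply: qe; apply: lt_le_trans s'e; rewrite ltrN2.
move=> y y0; have [->|u0] := eqVneq u 0.
  rewrite (_ : numform N 0 = 0).
    by rewrite /ratval /ceval rmorph0 horner0 mul0r.
  by rewrite /numform big1// => i _; rewrite big1// => j _; rewrite !mxE mul0r scale0r.
have eN : `|- e| = e by rewrite normrN gtr0_norm.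
have : posdef (nimx N q (Complex (- e) y)).
  have [yb|yb] := leP y b^-1; first by apply: aP; rewrite ?eN.
  by apply: bP; rewrite ?eN.
by move=> /(_ u u0); rewrite qform_nimx; lra.
Qed.

End MatrixSufficiency.

(** * Complex limits and fractions of polynomials *)

Section ComplexLimits.
Context {R : realType}.
Implicit Types (a b p : {poly R[i]}) (s : R[i]).

Lemma horner_continuousC p : continuous (fun z : R[i]^o => p.[z] : R[i]^o).
Proof.
elim/poly_ind: p => [|p c IH].
  rewrite (_ : (fun z => _) = cst (0 : R[i]^o)); first exact: cst_continuous.
  by apply/funext => z; rewrite horner0.
rewrite (_ : (fun z => _) =
    (fun z : R[i]^o => (p.[z] : R[i]^o) * z + c)); last first.
  by apply/funext => z; rewrite hornerMXaddC.
move=> z; apply: (@cvgD _ _ _ (nbhs z)); last exact: cst_continuous.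
exact: (@cvgM R[i]^o R[i]^o (nbhs z) _ _ _ _ _ (IH z) cvg_id).
Qed.

Lemma horner_derivableC p (s : R[i]^o) :
  derivable (fun z : R[i]^o => p.[z] : R[i]^o) s 1.
Proof.
elim/poly_ind: p => [|p c IH].
  rewrite (_ : (fun z => _) = cst (0 : R[i]^o)); first exact: derivable_cst.
  by apply/funext => z; rewrite horner0.
rewrite (_ : (fun z => _) =
    (fun z : R[i]^o => p.[z] : R[i]^o) * id + cst (c : R[i]^o)); last first.
  by apply/funext => z; rewrite hornerMXaddC.
apply: derivableD; last exact: derivable_cst.
by apply: derivableM; [exact: IH|exact: derivable_id].
Qed.

Lemma near_horner_neq0 a (s : R[i]^o) : a != 0 ->
  \forall z \near s^', a.[z] != 0.
Proof.
move=> a0; have [k [r]] := multiplicity_XsubC a s.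
rewrite a0 rootE /= => r0 aE.
have := cvgr_neq0 _ (@horner_continuousC r s) r0.
have near_s : (\forall z \near s, r.[z] != 0) ->
    \forall z \near s, z != s -> a.[z] != 0.
  apply: filterS => z rz zs.
  by rewrite aE hornerM horner_exp hornerXsubC mulf_neq0// expf_neq0// subr_eq0.
by move=> h; exact: (near_s (h (nbhs_filter _))).
Qed.

(** The case of interest is a pole, or the point at infinity, where a vanishes
    at s. *)
Lemma quotient_limit (f : R[i]^o -> R[i]^o) a b (s L : R[i]^o) :
  f z @[z --> s^'] --> L -> (\forall z \near s^', f z * a.[z] = b.[z]) ->
  L * a.[s] = b.[s].
Proof.
move=> fL fab.
have pc p : (p.[z] : R[i]^o) @[z --> s^'] --> (p.[s] : R[i]^o).
  apply: cvg_within_filter; exact: horner_continuousC.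
have PF : ProperFilter s^' := Proper_dnbhs_regular_numFieldType s.
have H1 := @cvgM R[i]^o R[i]^o s^' PF f (fun z => a.[z]) L a.[s] fL (pc a).
have H2 : (f \* (fun z : R[i]^o => a.[z] : R[i]^o)) z @[z --> s^'] -->
    (b.[s] : R[i]^o).
  apply: cvg_trans (pc b); apply: near_eq_cvg.
  by apply: filterS fab => z /esym.
have PF2 := fmap_proper_filter (f \* (fun z : R[i]^o => a.[z] : R[i]^o)) PF.
exact: (@norm_cvg_unique R[i] R[i]^o _ PF2 _ _ H1 H2).
Qed.

Lemma real_complex_continuous :
  continuous (fun x : R => x%:C%C : R[i]^o).
Proof.
move=> x; apply/cvgrPdist_lt => e e0.
have [r0 eE] : 0 < complex.Re e /\ e = (complex.Re e)%:C%C.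
  by move: e0; case: (e) => e1 e2; rewrite ltcE /= => /andP[/eqP -> ->].
near=> y; rewrite -rmorphB eE normc_def /= expr0n addr0 sqrtr_sqr ltcR.
by near: y; exact: cvgr_dist_lt.
Unshelve. all: by end_near.
Qed.

Lemma cvg_mx_entries (T : Type) (F : set_system T) {FF : Filter F} (m n : nat)
    (f : T -> 'M[R[i]^o]_(m, n)) (L : 'M[R[i]^o]_(m, n)) :
  (forall i j, (fun t => f t i j) @ F --> L i j) -> f @ F --> L.
Proof.
move=> fL A [P LP PA]; rewrite /nbhs /=.
have : \forall t \near F, forall i j, P i j (f t i j).
  by apply: filter_forall => i; apply: filter_forall => j; exact: fL.
by apply: filterS => t h; exact: PA.
Qed.

Lemma cvg_mx_entry (T : Type) (F : set_system T) {FF : Filter F} (m n : nat)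
    (f : T -> 'M[R[i]^o]_(m, n)) (L : 'M[R[i]^o]_(m, n)) i j :
  f @ F --> L -> (fun t => f t i j) @ F --> L i j.
Proof.
move=> fL; exact: (cvg_comp _ _ fL (@coord_continuous R[i]^o m n i j L)).
Qed.

End ComplexLimits.

Section FractionForm.
Context {R : realType}.

Lemma fden_neq0 (f : {fraction {poly R[i]}}) : fden f != 0.
Proof.
rewrite /fden; have := denom_ratioP (repr f).
case: (fraction.frac (repr f)) => n d /= d0.
rewrite divp_eq0 (negPf d0) gcdp_eq0 (negPf d0) andbF /= -leqNgt.
by apply: dvdp_leq => //; exact: dvdp_gcdr.
Qed.

Lemma fnum_fden_coprime (f : {fraction {poly R[i]}}) : coprimep (fnum f) (fden f).
Proof.
rewrite /fnum /fden; have := denom_ratioP (repr f).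
case: (fraction.frac (repr f)) => n d /= d0.
by apply: coprimep_div_gcd; rewrite d0 orbT.
Qed.

Lemma real_poly_of_conj (f : {poly R[i]}) : map_poly conjc f = f ->
  map_poly (real_complex R) (map_poly (@complex.Re R) f) = f.
Proof.
move=> fJ; apply/polyP => i; rewrite !coef_map_id0//.
have : (f`_i)^*%C = f`_i by rewrite -[in RHS]fJ coef_map_id0 ?conjc0.
by case: (f`_i) => a b [] bE; congr Complex; lra.
Qed.

Lemma poly_eq0_real (f : {poly R[i]}) : (forall t : R, f.[t%:C%C] = 0) -> f = 0.
Proof.
move=> f0; apply: (@poly_eq0_inj _ (fun n => (n%:R : R)%:C%C)) => [i j|i].
  by move/complexI/eqP; rewrite eqr_nat => /eqP.
exact: f0.
Qed.

End FractionForm.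

(** * Common real denominator *)

Section RealFraction.
Context {R : realType} {m : nat}.
Context (G : 'M[{fraction {poly R[i]}}]_m).

Definition common_den : {poly R[i]} := \prod_i \prod_j fden (G i j).

Lemma common_den_root s : common_den.[s] = 0 <-> pole G s.
Proof.
rewrite /common_den horner_prod; split.
  move/eqP/prodf_eq0 => [i _]; rewrite horner_prod => /prodf_eq0[j _] ij.
  by exists i, j.
move=> [i [j ij]]; apply/eqP/prodf_eq0; exists i => //.
by rewrite horner_prod; apply/prodf_eq0; exists j.
Qed.

Lemma common_den_neq0 : common_den != 0.
Proof. by apply/prodf_neq0 => i _; apply/prodf_neq0 => j _; exact: fden_neq0. Qed.

Lemma fden_dvd i j : fden (G i j) %| common_den.
Proof.
rewrite /common_den (bigD1 i)//= (bigD1 j)//= -mulrA.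
exact: dvdp_mulr.
Qed.

(** Multiplication by the conjugate polynomial makes the denominator real, and its
    roots the poles together with their conjugates. *)
Definition real_den : {poly R} :=
  map_poly (@complex.Re R) (common_den * map_poly conjc common_den).
Definition real_num : 'M[{poly R}]_m := \matrix_(i, j) map_poly (@complex.Re R)
  (fnum (G i j) * (common_den %/ fden (G i j)) * map_poly conjc common_den).

Lemma map_conjcK (f : {poly R[i]}) : map_poly conjc (map_poly conjc f) = f.
Proof.
by apply/polyP => i; rewrite !coef_map_id0 ?conjc0// conjcK.
Qed.

Lemma horner_conjc (f : {poly R[i]}) s : (map_poly conjc f).[s] = (f.[s^*%C])^*%C.
Proof. by rewrite -[in LHS](conjcK s) horner_map. Qed.

Lemma map_real_den :
  map_poly (real_complex R) real_den = common_den * map_poly conjc common_den.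
Proof.
by apply: real_poly_of_conj; rewrite rmorphM /= map_conjcK mulrC.
Qed.

Lemma ceval_real_den s :
  ceval real_den s = common_den.[s] * (common_den.[s^*%C])^*%C.
Proof. by rewrite /ceval map_real_den hornerM horner_conjc. Qed.

Lemma real_den_neq0 : real_den != 0.
Proof.
apply/eqP => q0; have := map_real_den; rewrite q0 rmorph0 => /esym/eqP.
rewrite mulf_eq0 (negPf common_den_neq0) /= => /eqP h.
by have := common_den_neq0; rewrite -[common_den]map_conjcK h rmorph0 eqxx.
Qed.

Lemma real_den_root s : ceval real_den s = 0 <-> pole G s \/ pole G s^*%C.
Proof.
rewrite ceval_real_den; split.
  move/eqP; rewrite mulf_eq0 conjc_eq0.
  by move=> /orP[]/eqP/common_den_root; [left|right].
by case=> /common_den_root ->; rewrite ?mul0r// conjc0 mulr0.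
Qed.

Context (G_real : real_tf (tf_eval G)).

(** On the real axis both G and the denominator are real, hence so is the
    numerator, which is determined by its values there. *)
Lemma map_real_num i j : map_poly (real_complex R) (real_num i j) =
  fnum (G i j) * (common_den %/ fden (G i j)) * map_poly conjc common_den.
Proof.
rewrite mxE; apply: real_poly_of_conj.
set f := _ * _ * _; apply/eqP; rewrite -subr_eq0; apply/eqP.
apply: poly_eq0_real => t; rewrite hornerD hornerN horner_conjc conjc_real.
set x := t%:C%C; rewrite /f !hornerM horner_conjc conjc_real -/x.
have [->|dx] := eqVneq common_den.[x] 0; first by rewrite conjc0 !mulr0 conjc0 subr0.
have dE : common_den.[x] = (common_den %/ fden (G i j)).[x] * (fden (G i j)).[x].
  by rewrite -hornerM divpK// fden_dvd.
have d0 : (fden (G i j)).[x] != 0.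
  by apply: contra dx => /eqP d0; rewrite dE d0 mulr0.
have FE : ((fnum (G i j)).[x] / (fden (G i j)).[x])^*%C =
    (fnum (G i j)).[x] / (fden (G i j)).[x].
  have /matrixP/(_ i j) := G_real x; rewrite !mxE.
  by rewrite (_ : x^* = x)//; exact: conjc_real.
have -> : (fnum (G i j)).[x] * (common_den %/ fden (G i j)).[x] *
    (common_den.[x])^*%C = (fnum (G i j)).[x] / (fden (G i j)).[x] *
    (common_den.[x] * (common_den.[x])^*%C).
  by rewrite [X in _ * (X * _)]dE; field.
move: FE; move: (_ / (fden (G i j)).[x]) => A FE.
have conjM (u v : R[i]) : (u * v)^*%C = u^*%C * v^*%C by exact: rmorphM.
by rewrite !conjM FE conjcK [_^*%C * _]mulrC subrr.
Qed.

Lemma tf_evalE s i j : ceval real_den s != 0 ->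
  tf_eval G s i j = ratval (real_num i j) real_den s.
Proof.
rewrite /ratval ceval_real_den mulf_eq0 negb_or => /andP[ds cs].
rewrite /ceval map_real_num !hornerM horner_conjc mxE.
have dE : common_den.[s] = (common_den %/ fden (G i j)).[s] * (fden (G i j)).[s].
  by rewrite -hornerM divpK// fden_dvd.
have := ds; rewrite dE mulf_eq0 negb_or => /andP[a0 d0].
by field; rewrite a0 d0 cs.
Qed.

Lemma real_num_sym : symmetric_tf (tf_eval G) -> real_num^T = real_num.
Proof.
move=> Gs; apply/matrixP => i j; rewrite mxE.
apply/eqP; rewrite -subr_eq0; apply/eqP.
apply: (@map_poly_inj _ _ (real_complex R)); rewrite rmorph0.
apply: (mulIf (x := map_poly (real_complex R) real_den)).
  by rewrite map_poly_eq0 real_den_neq0.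
rewrite mul0r; apply: poly_eq0_real => t; rewrite hornerM -/(ceval real_den _).
have [->|q0] := eqVneq (ceval real_den t%:C%C) 0; first by rewrite mulr0.
rewrite rmorphB hornerD hornerN -!/(ceval _ _).
have /matrixP/(_ i j) := Gs t%:C%C; rewrite [in RHS]mxE !tf_evalE// /ratval.
by move/(mulIf (invr_neq0 q0)) => ->; rewrite subrr mul0r.
Qed.

(** A pole at infinity is excluded: clearing denominators in the variable 1 / s,
    the limit forces the leading coefficient of the numerator to vanish. *)
Lemma real_num_size : proper_tf (tf_eval G) ->
  forall i j, (size (real_num i j) <= size real_den)%N.
Proof.
move=> [D GD] i j; rewrite leqNgt; apply/negP => lt_qp.
set p := real_num i j in lt_qp *; set q := real_den in lt_qp.
have p0 : p != 0 by rewrite -size_poly_gt0; apply: leq_ltn_trans lt_qp.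
pose n := (size p).-1.
have pn : (size p <= n.+1)%N by rewrite /n prednK// size_poly_gt0.
have qn : (size q <= n.+1)%N by apply: leq_trans pn; exact: ltnW.
have a0 : map_poly (real_complex R) (revp n q) != 0.
  rewrite map_poly_eq0; apply/eqP => r0.
  have := revpK qn; rewrite r0 => q0; have := real_den_neq0; rewrite -/q -q0.
  by rewrite /revp; apply/negP; rewrite negbK; apply/eqP/polyP => k;
    rewrite coef_poly !coef0; case: ifP.
have PF : ProperFilter (0 : R[i]^o)^' := Proper_dnbhs_regular_numFieldType _.
have lim := @cvg_mx_entry R _ _ PF m m _ _ i j GD.
have := quotient_limit lim (a := map_poly (real_complex R) (revp n q))
  (b := map_poly (real_complex R) (revp n p)).
have near_eq : \forall z \near (0 : R[i]^o)^',
    (tf_eval G z^-1 i j : R[i]^o) * (map_poly (real_complex R) (revp n q)).[z] =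
    (map_poly (real_complex R) (revp n p)).[z].
  have hz : \forall z \near (0 : R[i]^o)^', z != 0.
    exact: nbhs_dnbhs_neq.
  apply: filterS2 hz (near_horner_neq0 _ a0) => z z0 az.
  have zi0 : z^-1 != 0 by rewrite invr_eq0.
  have qz : ceval q z^-1 != 0.
    apply: contra az => /eqP qz.
    by rewrite map_revp revpE ?size_map_poly// -/(ceval q _) qz mulr0.
  rewrite tf_evalE// (ratval_inv pn qn zi0) invrK /ratval.
  by rewrite -[X in _ / _ * X]/(ceval _ _) divfK.
move=> /(_ near_eq).
rewrite -[_.[0]]/(ceval (revp n q) 0%:C%C) -[RHS]/(ceval (revp n p) 0%:C%C).
rewrite !ceval_real !revp0 [q`_n]nth_default; last first.
  by rewrite -ltnS; rewrite /n prednK// size_poly_gt0.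
rewrite mulr0 => /esym/complexI/eqP; rewrite -/(lead_coef p) lead_coef_eq0.
exact/negP.
Qed.

End RealFraction.

(** * Negative imaginary transfer functions *)

Section Bridges.
Context {R : realType} {m : nat}.
Implicit Types (q : {poly R}) (N : 'M[{poly R}]_m) (u : 'rV[R]_m).
Context (G : 'M[{fraction {poly R[i]}}]_m).

Lemma ni_formE (F : R[i] -> 'M[R[i]]_m) s : symmetric_tf F ->
  ni_form (F s) = cmx (\matrix_(i, j) (-2 * complex.Im (F s i j))).
Proof.
move=> Fs; apply/matrixP => i j; rewrite !mxE.
have /matrixP/(_ i j) := Fs s; rewrite mxE => <-.
rewrite -[Num.conj _]/(conjc _); case: (F s i j) => a b /=.
by rewrite -[LHS]/(Complex _ _); congr Complex; ring.
Qed.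

Lemma nimx_sym N q s : N^T = N -> (nimx N q s)^T = nimx N q s.
Proof. by move=> Ns; apply/matrixP => i j; rewrite !mxE -[in RHS]Ns mxE. Qed.

Lemma nimx_quot_sym N q z : N^T = N -> (nimx_quot N q z)^T = nimx_quot N q z.
Proof. by move=> Ns; apply/matrixP => i j; rewrite !mxE -[in RHS]Ns mxE. Qed.

(** An entry takes the value 0 at a pole, so continuity there would force the
    numerator to vanish too, against coprimality. *)
Lemma derivable_no_pole (c s : R[i]^o) i j :
  derivable (fun z : R[i]^o => tf_eval G (z - c) i j : R[i]^o) (s + c) 1 ->
  ~ root (fden (G i j)) s.
Proof.
move=> /derivable1_diffP d ds.
have fc : {for (s + c : R[i]^o),
    continuous (fun z : R[i]^o => tf_eval G (z - c) i j : R[i]^o)}.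
  exact: (differentiable_continuous d).
have fL := (continuous_withinNx _ _).1 fc.
pose l : {poly R[i]} := 'X - c%:P.
pose a := fden (G i j) \Po l; pose b := fnum (G i j) \Po l.
have lE z : l.[z] = z - c by rewrite hornerXsubC.
have a0 : a != 0 by rewrite comp_poly2_eq0 ?size_XsubC// fden_neq0.
have := quotient_limit fL (a := a) (b := b).
have near_eq : \forall z \near ((s + c : R[i]^o)^'),
    (tf_eval G (z - c) i j : R[i]^o) * a.[z] = b.[z].
  apply: filterS (near_horner_neq0 _ a0) => z; rewrite /a /b !horner_comp !lE mxE.
  by move=> dz; rewrite divfK.
move=> /(_ near_eq); rewrite mxE addrK /a /b !horner_comp !lE !addrK.
move: (ds); rewrite rootE => /eqP ->; rewrite mulr0 => /esym ns.
have := fnum_fden_coprime (G i j); rewrite coprimep_sym => /coprimep_root/(_ ds).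
by rewrite ns eqxx.
Qed.

Lemma no_pole_derivable (c s : R[i]^o) i j : ~ root (fden (G i j)) (s - c) ->
  derivable (fun z : R[i]^o => tf_eval G (z - c) i j : R[i]^o) s 1.
Proof.
move=> ds.
pose l : {poly R[i]} := 'X - c%:P.
have lE z : l.[z] = z - c by rewrite hornerXsubC.
have -> : (fun z : R[i]^o => tf_eval G (z - c) i j : R[i]^o) =
    (fun z : R[i]^o => (fnum (G i j) \Po l).[z] : R[i]^o) *
    (fun z : R[i]^o => ((fden (G i j) \Po l).[z])^-1 : R[i]^o).
  by apply/funext => z; rewrite mxE -!lE -!horner_comp.
apply: derivableM; first exact: horner_derivableC.
apply: derivableV; last exact: horner_derivableC.
by rewrite horner_comp lE; apply/negP => h; apply: ds; rewrite rootE.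
Qed.

Lemma ReJ (s : R[i]) : complex.Re s^*%C = complex.Re s. Proof. by case: s. Qed.
Lemma ImJ (s : R[i]) : complex.Im s^*%C = - complex.Im s. Proof. by case: s. Qed.

Lemma stable_of_poles e : (forall s, - e < complex.Re s -> ~ pole G s) ->
  stable e (real_den G).
Proof.
move=> Ge s se; apply/eqP => /real_den_root[]; first exact: Ge.
by apply: Ge; rewrite ReJ.
Qed.

(** The poles are the roots of a single polynomial, hence finite in number. *)
Lemma stability_margin : (forall s, pole G s -> complex.Re s < 0) ->
  exists2 e, 0 < e & forall s, - e < complex.Re s -> ~ pole G s.
Proof.
move=> Gs; have [r rE] := closed_field_poly_normal (common_den G).
have rpole s : s \in r -> pole G s.
  move=> sr; apply/common_den_root; rewrite rE hornerZ.
  rewrite [X in _ * X](_ : _ = 0) ?mulr0//.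
  by apply/eqP; rewrite -rootE root_prod_XsubC.
have [e e0 er] : exists2 e : R, 0 < e & forall s, s \in r -> complex.Re s <= - e.
  elim: r {rE} rpole => [|z r IH] rpole; first by exists 1.
  have [s sr|e e0 er] := IH; first by apply: rpole; rewrite inE sr orbT.
  have z0 : complex.Re z < 0 by apply: Gs; apply: rpole; rewrite inE eqxx.
  exists (Num.min e (- complex.Re z)); first by rewrite lt_min e0 oppr_gt0.
  move=> s; rewrite inE => /orP[/eqP ->|/er].
    by rewrite lerNr ge_min lexx orbT.
  by move=> h; rewrite lerNr ge_min lerNr h.
exists e => // s se /common_den_root; rewrite rE hornerZ => /eqP.
rewrite mulf_eq0 lead_coef_eq0 (negPf (common_den_neq0 G)) /= -rootE root_prod_XsubC.
by move=> /er; rewrite leNgt se.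
Qed.

Context (G_real : real_tf (tf_eval G)).
Context (G_sym : symmetric_tf (tf_eval G)).

Let N := real_num G.
Let q := real_den G.

Lemma ni_form_nimx s : ceval q s != 0 ->
  ni_form (tf_eval G s) = cmx (nimx N q s).
Proof.
move=> qs; rewrite ni_formE//; congr cmx; apply/matrixP => i j.
by rewrite [LHS]mxE [RHS]mxE tf_evalE.
Qed.

Lemma realJ s : tf_eval G s^*%C = map_mx Num.conj (tf_eval G s).
Proof. by rewrite G_real. Qed.

(** If some form had constant numerator over the denominator, positivity would
    force a real vector into the kernel of G(s) - G(-s)^T on the imaginary axis,
    hence everywhere. *)
Lemma nonconstant_form e : 0 < e -> stable e q ->
  (forall s, - e < complex.Re s -> 0 < complex.Im s ->
    forall u, 0 <= qform (nimx N q s) u) ->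
  full_normal_rank [set s | - e < complex.Re s < e]
      (fun s => 'i%C *: (tf_eval G s - (tf_eval G (- s))^T)) ->
  forall u, u != 0 -> forall c, numform N u != c *: q.
Proof.
move=> e0 qe Pe [s0 /= /andP[s0l s0r] dets0] u u0 c; apply/eqP => uc.
have eN : - e < 0 by rewrite oppr_lt0.
pose neg (p : {poly R}) := p \Po (- 'X).
have negE p s : ceval (neg p) s = ceval p (- s).
  rewrite /ceval /neg map_comp_poly horner_comp rmorphN /= map_polyX.
  by rewrite hornerN hornerX.
have Ns : N^T = N by exact: real_num_sym.
have nullP w : 0 < w -> u *m nimx N q (Complex 0 w) = 0.
  move=> w0; apply: psd_null; first exact: nimx_sym.
    by move=> v; apply: Pe.
  rewrite qform_nimx uc /ratval cevalZ mulfK; last exact: qe.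
  by rewrite /= mulr0.
pose V j : {poly R} := \sum_i u 0 i *: (N i j * neg q - neg (N i j) * q).
have cevalV j s : ceval q s != 0 -> ceval q (- s) != 0 -> ceval (V j) s =
    ceval q s * ceval q (- s) *
    \sum_i (u 0 i)%:C%C * (tf_eval G s i j - tf_eval G (- s) i j).
  move=> qs qs'; rewrite /V [in LHS]/ceval rmorph_sum horner_sum mulr_sumr.
  apply: eq_bigr => i _.
  rewrite -[LHS]/(ceval (u 0 i *: (N i j * neg q - neg (N i j) * q)) s).
  rewrite cevalZ cevalD.
  have cevalN p : ceval (- p) s = - ceval p s by rewrite /ceval rmorphN hornerN.
  rewrite cevalN !cevalM !negE !tf_evalE// /ratval -/N -/q.
  by field; rewrite qs qs'.
have V0 j : V j = 0.
  apply: (@map_poly_inj _ _ (real_complex R)); rewrite rmorph0.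
  apply: (@poly_eq0_inj _ (fun n => Complex 0 (n.+1%:R : R))) => [k l|n].
    by move=> [] /eqP; rewrite eqr_nat eqSS => /eqP.
  have w0 : 0 < n.+1%:R :> R by rewrite ltr0n.
  set s := Complex 0 _.
  have sJ : - s = s^*%C by rewrite /s /= -[LHS]/(Complex _ _) oppr0.
  have qs : ceval q s != 0 by exact: qe.
  have qs' : ceval q (- s) != 0 by apply: qe; rewrite sJ ReJ.
  rewrite -/(ceval _ _) cevalV//.
  have := nullP _ w0 => /rowP/(_ j); rewrite !mxE => h.
  rewrite [X in _ * X](_ : _ = - 'i%C * (\sum_k u 0 k * nimx N q s k j)%:C%C).
    by rewrite h rmorph0 !mulr0.
  rewrite rmorph_sum mulr_sumr; apply: eq_bigr => i _.
  rewrite sJ realJ [in X in _ - X]mxE [nimx _ _ _ _ _]mxE tf_evalE//.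
  rewrite -[Num.conj _]/(conjc _); case: (ratval _ _ _) => a b /=.
  by rewrite -[LHS]/(Complex _ _) -[RHS]/(Complex _ _); congr Complex; ring.
have qs0 : ceval q s0 != 0 by exact: qe.
have qs0' : ceval q (- s0) != 0.
  by apply: qe; case: (s0) s0r => a b /=; rewrite ltrN2.
move/negP: dets0; apply; apply/det0P.
exists (map_mx (real_complex R) u); first by rewrite map_mx_eq0.
rewrite -scalemxAr -G_sym; apply/rowP => j; rewrite [RHS]mxE [LHS]mxE.
rewrite [X in _ * X](_ : _ = 0) ?mulr0//.
have := cevalV j s0 qs0 qs0'; rewrite V0 /ceval rmorph0 horner0 => /esym/eqP.
rewrite mulf_eq0 (negPf (mulf_neq0 qs0 qs0')) /= => /eqP h.
by rewrite mxE -[RHS]h; apply: eq_bigr => i _; rewrite !mxE.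
Qed.

Lemma pd_det_neq0 (A : 'M[R[i]]_m) : pd A -> \det A != 0.
Proof.
move=> [_ A0]; apply/det0P => -[v v0 vA].
have := A0 (v ^t*); rewrite trmxCK vA mul0mx mxE ltxx => h.
suff : v ^t* != 0 by move/h.
apply: contra v0 => /eqP v0; rewrite -[v]trmxCK v0.
by apply/eqP/matrixP => i j; rewrite !mxE rmorph0.
Qed.

Lemma nimx_quot0_limit :
  ceval q 0 != 0 -> (cmx (nimx_quot N q (0, w)) : 'M[R[i]^o]_m) @[w --> (0 : R)] -->
    (cmx (nimx_quot N q (0, 0)) : 'M[R[i]^o]_m).
Proof.
move=> q0; apply: cvg_mx_entries => i j.
have -> : (fun w => (cmx (nimx_quot N q (0, w)) : 'M[R[i]^o]_m) i j) =
    (fun w : R => (nimx_quot N q (0, w) i j)%:C%C : R[i]^o).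
  by apply/funext => w; rewrite mxE.
have ct : ((0 : R), w) @[w --> (0 : R)] --> ((0 : R), (0 : R)).
  exact: (cvg_pair (cvg_cst (0 : R)) cvg_id).
have cK := cvg_comp _ _ ct (@nimx_quot_continuous _ _ N q (0, 0) i j q0).
have := cvg_comp _ _ cK (@real_complex_continuous R _).
by rewrite [X in _ -> _ --> X]mxE.
Qed.

Lemma ni_form_limit (e : R) : 0 < e -> stable e q ->
  (((w^-1)%:C%C *: ni_form (tf_eval G (Complex 0 w)) : 'M[R[i]^o]_m)
     @[w --> (0 : R)^'+] --> (cmx (nimx_quot N q (0, 0)) : 'M[R[i]^o]_m)).
Proof.
move=> e0 qe.
have q0 : ceval q 0 != 0 by apply: qe; rewrite /= oppr_lt0.
apply: cvg_trans (cvg_at_right_filter (nimx_quot0_limit q0)).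
apply: near_eq_cvg; move: (nbhs_right_gt (0 : R)); apply: filterS => w w0.
rewrite ni_form_nimx; last by apply: qe; rewrite /= oppr_lt0.
rewrite nimx_quotE /cmx map_mxZ scalerA -rmorphM mulVf ?gt_eqF//.
by rewrite rmorph1 scale1r.
Qed.

End Bridges.

Theorem theorem3 (R : realType) (m : nat) (m_gt0 : (0 < m)%N)
    (G : 'M[{fraction {poly R[i]}}]_m)
    (G_sym : symmetric_tf (tf_eval G))
    (G_real : real_tf (tf_eval G))
    (G_proper : proper_tf (tf_eval G)) :
  C_SSNI (tf_eval G) <->
  [/\ forall s : R[i], pole G s -> complex.Re s < 0,
      forall w : R, 0 < w -> pd (ni_form (tf_eval G (Complex 0 w))),
      exists sigma0 delta : R, [/\ 0 < sigma0, 0 < delta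
        & forall w : R, delta <= w ->
            sigma0 < min_singular_value
              ((w ^+ 3)%:C%C *: ni_form (tf_eval G (Complex 0 w)))]
    & exists2 Q : 'M[R[i]^o]_m,
        ((w^-1)%:C%C *: ni_form (tf_eval G (Complex 0 w)) : 'M[R[i]^o]_m)
          @[w --> (0 : R)^'+] --> Q
        & pd (Q : 'M[R[i]]_m)].
Proof.
pose N := real_num G; pose q := real_den G; pose n := (size q).-1.
have qn : (size q <= n.+1)%N by rewrite /n prednK// size_poly_gt0 real_den_neq0.
have qn0 : q`_n != 0 by rewrite -/(lead_coef q) lead_coef_eq0 real_den_neq0.
have Nn i j : (size (N i j) <= n.+1)%N.
  by apply: (leq_trans (real_num_size G_real G_proper i j)).
have Ns : N^T = N by exact: real_num_sym.
have niP s : ceval q s != 0 -> ni_form (tf_eval G s) = cmx (nimx N q s).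
  exact: ni_form_nimx.
have ni3 w : ceval q (Complex 0 w) != 0 ->
    (w ^+ 3)%:C%C *: ni_form (tf_eval G (Complex 0 w)) =
    cmx (w ^+ 3 *: nimx N q (Complex 0 w)).
  by move=> qw; rewrite niP// /cmx map_mxZ.
have sym3 (w : R) s : (w *: nimx N q s)^T = w *: nimx N q s.
  by rewrite linearZ /= nimx_sym.
split.
  move=> [_ [e e0 [[Gan Gni] Gfnr]]].
  have eN : - e < 0 by rewrite oppr_lt0.
  have nopole s : - e < complex.Re s -> ~ pole G s.
    move=> se [i [j]]; apply: (@derivable_no_pole R m G e%:C%C).
    by apply: Gan; case: s se => a b /=; lra.
  have qe : stable e q := stable_of_poles nopole.
  have Pe s : - e < complex.Re s -> 0 < complex.Im s ->
      forall u, 0 <= qform (nimx N q s) u.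
    move=> se s0; apply/psd_cmx; first exact: nimx_sym.
    rewrite -niP; last exact: qe.
    have := Gni (s + e%:C%C); rewrite addrK.
    have -> : complex.Re (s + e%:C%C) = complex.Re s + e by case: (s).
    have -> : complex.Im (s + e%:C%C) = complex.Im s.
      by case: (s) => ? ? /=; rewrite addr0.
    by case=> [|+ _ _]; [lra|apply].
  have NC := nonconstant_form G_real G_sym e0 qe Pe Gfnr.
  have [c1 [c [d [c0 d0 c2]]] c3] := ni_necessary e0 qe Pe NC Nn qn qn0.
  have qiw w : ceval q (Complex 0 w) != 0 by exact: qe.
  split.
  - move=> s ps; rewrite ltNge; apply/negP => s0; apply: nopole ps.
    exact: lt_le_trans s0.
  - by move=> w w0; rewrite niP//; apply/pd_cmx; [exact: nimx_sym|exact: c1].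
  - exists (c / 2), d; split; [by rewrite divr_gt0|by []|move=> w dw].
    have := min_singular_value_ge m_gt0 (sym3 (w ^+ 3) (Complex 0 w)) c0 (c2 w dw).
    by rewrite ni3//; apply: lt_le_trans; lra.
  - exists (cmx (nimx_quot N q (0, 0))); first exact: ni_form_limit qe.
    by apply/pd_cmx; [exact: nimx_quot_sym|].
move=> [Gpole Gpd [c [d [c0 d0 Gsv]]] [Q limQ pdQ]].
have [e0 e00 nopole] := stability_margin Gpole.
have qe : stable e0 q := stable_of_poles nopole.
have e0N : - e0 < 0 by rewrite oppr_lt0.
have qiw w : ceval q (Complex 0 w) != 0 by exact: qe.
have Pw w : 0 < w -> posdef (nimx N q (Complex 0 w)).
  by move=> w0; apply/pd_cmx; [exact: nimx_sym|rewrite -niP//; exact: Gpd].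
have P3 : exists c d, [/\ 0 < c, 0 < d & forall w, d <= w -> forall u,
    c * sqnorm u <= qform (w ^+ 3 *: nimx N q (Complex 0 w)) u].
  exists c, d; split => // w dw.
  have w0 : 0 < w by lra.
  apply: min_singular_value_coercive => //.
    by move=> u u0; rewrite qformZ mulr_gt0 ?exprn_gt0//; exact: Pw.
  by rewrite -ni3//; exact: Gsv.
have K0 : posdef (nimx_quot N q (0, 0)).
  apply/pd_cmx; first exact: nimx_quot_sym.
  have PF : ProperFilter (0 : R)^'+ by exact: at_right_proper_filter.
  have lim2 := ni_form_limit G_real G_sym e00 qe.
  have -> // : cmx (nimx_quot N q (0, 0)) = Q.
  apply/matrixP => i j.
  have l1 := @cvg_mx_entry R _ _ PF m m _ _ i j limQ.
  have l2 := @cvg_mx_entry R _ _ PF m m _ _ i j lim2.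
  have PF2 := fmap_proper_filter (fun w : R => ((w^-1)%:C%C *:
    ni_form (tf_eval G (Complex 0 w)) : 'M[R[i]^o]_m) i j) PF.
  exact: (@norm_cvg_unique R[i] R[i]^o _ PF2 _ _ l2 l1).
have [e [e1 e2 Pe]] := ni_sufficient e00 qe Nn qn qn0 Pw P3 K0.
have qe1 s : - e < complex.Re s -> ceval q s != 0.
  by move=> se; apply: qe; lra.
split=> //; exists e => //; split; last first.
  (* At s = i the matrix is i (G - G^H), which is positive definite. *)
  exists (Complex 0 1); first by rewrite /= oppr_lt0 e1.
  have -> : - Complex 0 1 = (Complex 0 1 : R[i])^*%C.
    by rewrite -[LHS]/(Complex _ _) /= oppr0.
  rewrite realJ// map_trmx.
  exact/pd_det_neq0/Gpd.
split=> [s /= s0 i j|s s0].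
  apply: no_pole_derivable => ps; apply: (nopole (s - e%:C%C)); last by exists i, j.
  by case: (s) s0 => a b /=; lra.
set z := s - e%:C%C.
have zR : - e < complex.Re z by rewrite /z; case: (s) s0 => a b /=; lra.
have zI : complex.Im z = complex.Im s.
  by rewrite /z; case: (s) => a b /=; rewrite subr0.
rewrite -zI niP; last exact: qe1.
split=> sI.
- by apply/psd_cmx; [exact: nimx_sym|exact: Pe].
- have zJ : z = z^*%C by case: (z) sI => a b /= ->; rewrite oppr0.
  rewrite -niP; last exact: qe1.
  rewrite ni_formE//; apply/matrixP => i j; rewrite !mxE.
  have /matrixP/(_ i j) := realJ G_real z; rewrite -zJ !mxE.
  rewrite -[Num.conj _]/(conjc _); case: (_ / _) => a b [] h /=.
  by have -> : b = 0 by [lra]; rewrite mulr0.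
- rewrite /nsd (_ : - cmx (nimx N q z) = cmx (nimx N q z^*%C)).
    apply/psd_cmx; first exact: nimx_sym.
    by apply: Pe; rewrite ?ReJ ?ImJ// oppr_gt0.
  have qz : ceval q z != 0 by exact: qe1.
  have qzJ : ceval q z^*%C != 0 by apply: qe1; rewrite ReJ.
  have PE y i j : ceval q y != 0 ->
      cmx (nimx N q y) i j = (-2 * complex.Im (tf_eval G y i j))%:C%C.
    by move=> qy; rewrite tf_evalE// [LHS]mxE [nimx _ _ _ _ _]mxE.
  apply/matrixP => i j; rewrite [LHS]mxE !PE// realJ// [in RHS]mxE.
  rewrite -[Num.conj _]/(conjc _); case: (tf_eval G z i j) => a b /=.
  by rewrite -rmorphN; congr (_%:C%C); ring.
Qed.
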